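(* Let $m\ge 1$ and let $F_{2m}$ be free with basis $x_1,\dots,x_{2m}$. Every $\Delta$-primitive element of $F_{2m}$ is the image of $u_{2m}=[x_1,x_2][x_3,x_4]\cdots[x_{2m-1},x_{2m}]$ under some automorphism of $F_{2m}$.
   Context: $F=F_n$ is free with basis $x_1,\dots,x_n$; $\mathbb{Z}F$ is its integral group ring, $\varepsilon:\mathbb{Z}F\to\mathbb{Z}$ the augmentation map and $\Delta=\ker\varepsilon$ the augmentation ideal. $\Delta$ is a free left $\mathbb{Z}F$-module with basis $x_1-1,\dots,x_n-1$; for $a\in\Delta$ the (left) Fox derivatives $d_i(a)\in\mathbb{Z}F$ are the unique elements with $a=\sum_{i=1}^n d_i(a)(x_i-1)$, extended to all of $\mathbb{Z}F$ by $d_i(a)=d_i(a-\varepsilon(a))$ (so $d_i(1)=0$). For $g\in F$ the Fox derivatives of $g$ are $d_1(g),\dots,d_n(g)$. An element $u\in F$ is called $\Delta$-primitive if $d_1(u),\dots,d_n(u)$ generate $\Delta$ as a right ideal of $\mathbb{Z}F$. $[a,b]=a^{-1}b^{-1}ab$. *)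

(* Defs.v *)
From HB Require Import structures.
From mathcomp Require Import all_boot all_order all_algebra.
From mathcomp Require Import finmap.
From mathcomp Require Import zify.

Set Implicit Arguments.
Unset Strict Implicit.
Unset Printing Implicit Defensive.

Import GRing.Theory.
Local Open Scope fset_scope.

(* The free group F_n on x_0, ..., x_{n-1} (the paper's x_1..x_n),     *)
(* realised as freely reduced words.  A letter (i, false) is x_i and   *)
(* a letter (i, true) is x_i^{-1}.                                     *)

Section FreeGroup.
Variable n : nat.

Definition letter := ('I_n * bool)%type.

Definition lflip (l : letter) : letter := (l.1, ~~ l.2).

Definition redrel (x y : letter) : bool := y != lflip x.

Definition reducedw (w : seq letter) : bool := sorted redrel w.

Definition cons_red (l : letter) (w : seq letter) : seq letter :=
  if w is l' :: w' then (if l' == lflip l then w' else l :: w) else [:: l].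

Lemma cons_red_reduced l w : reducedw w -> reducedw (cons_red l w).
Proof.
case: w => [|l' w] //= H.
case: ifP => [_|/negbT Hne].
  by case: w H => //= a w /andP[].
by rewrite /reducedw /= /redrel Hne.
Qed.

Definition red (s : seq letter) : seq letter := foldr cons_red [::] s.

Lemma red_reduced s : reducedw (red s).
Proof. by elim: s => [|l s IH] //=; apply: cons_red_reduced. Qed.

Record FG := FGword { fgw : seq letter; _ : reducedw fgw }.

HB.instance Definition _ := [isSub for fgw].
HB.instance Definition _ := [Equality of FG by <:].
HB.instance Definition _ := [Choice of FG by <:].
HB.instance Definition _ := [Countable of FG by <:].

Definition mkFG (s : seq letter) : FG := FGword (red_reduced s).

Definition fg_one : FG := mkFG [::].
Definition fg_mul (a b : FG) : FG := mkFG (fgw a ++ fgw b).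
Definition fg_inv (a : FG) : FG := mkFG (rev (map lflip (fgw a))).
Definition fg_gen (i : 'I_n) : FG := mkFG [:: (i, false)].

Definition fg_comm (a b : FG) : FG :=
  fg_mul (fg_mul (fg_mul (fg_inv a) (fg_inv b)) a) b.

Definition fg_aut (phi : FG -> FG) : Prop :=
  {morph phi : a b / fg_mul a b} /\ bijective phi.

Definition ZF := {fsfun FG -> int with 0%R}.

Definition zf_zero : ZF := [fsfun x in fset0 => 0%R | 0%R].
Definition zf_of (g : FG) : ZF := [fsfun x in [fset g] => 1%R | 0%R].
Definition zf_one : ZF := zf_of fg_one.
Definition zf_add (a b : ZF) : ZF :=
  [fsfun x in finsupp a `|` finsupp b => (a x + b x)%R | 0%R].
Definition zf_opp (a : ZF) : ZF := [fsfun x in finsupp a => (- a x)%R | 0%R].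
Definition zf_sub (a b : ZF) : ZF := zf_add a (zf_opp b).
Definition zf_mul (a b : ZF) : ZF :=
  [fsfun x in [fset fg_mul y z | y in finsupp a, z in finsupp b] =>
     (\sum_(y <- finsupp a) a y * b (fg_mul (fg_inv y) x))%R | 0%R].

Definition zf_aug (a : ZF) : int := (\sum_(g <- finsupp a) a g)%R.

Definition zf_sumI (F : 'I_n -> ZF) : ZF := \big[zf_add/zf_zero]_(i < n) F i.

(* D_0, ..., D_{n-1} are the (left) Fox derivatives of u:
   u - 1 = sum_i D_i (x_i - 1)  (these are unique, Delta being a free left
   ZF-module on the x_i - 1, and d_i(u) = d_i(u - eps(u)) = d_i(u - 1)) *)
Definition fox_derivs (u : FG) (D : 'I_n -> ZF) : Prop :=
  zf_sub (zf_of u) zf_one =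
  zf_sumI (fun i => zf_mul (D i) (zf_sub (zf_of (fg_gen i)) zf_one)).

Definition gen_aug_right_ideal (D : 'I_n -> ZF) : Prop :=
  (forall i, zf_aug (D i) = 0%R) /\
  (forall a : ZF, zf_aug a = 0%R ->
     exists r : 'I_n -> ZF, a = zf_sumI (fun i => zf_mul (D i) (r i))).

Definition Delta_primitive (u : FG) : Prop :=
  exists D : 'I_n -> ZF, fox_derivs u D /\ gen_aug_right_ideal D.

End FreeGroup.

Lemma ord_even_lt (m : nat) (k : 'I_m) : 2 * k < 2 * m.
Proof. have := ltn_ord k; lia. Qed.

Lemma ord_odd_lt (m : nat) (k : 'I_m) : (2 * k).+1 < 2 * m.
Proof. have := ltn_ord k; lia. Qed.

Definition u_surface (m : nat) : FG (2 * m) :=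
  \big[@fg_mul (2 * m)/fg_one (2 * m)]_(k < m)
     fg_comm (fg_gen (Ordinal (ord_even_lt k))) (fg_gen (Ordinal (ord_odd_lt k))).

(* Main.v *)
(* Call phi : F -> Z almost invariant when g |-> phi(gk) - phi(g) has finite
   support for every k. Letting phi be the potential of the coefficients r_i,
   Delta-primitivity of u says that phi |-> phi(.u) - phi maps almost invariant
   functions onto the finitely supported functions of sum 0; this condition
   no longer mentions the basis, so it is invariant under automorphisms.

   Whitehead automorphisms replace u by a cyclically reduced word w whose
   Whitehead graph stays connected when a vertex is removed. Suppose that a
   letter x occurs twice in w. Two translates of the axis of w then cross the
   edge (1, x) of the Cayley tree in the same direction; choose phi with jump +1
   along the first, -1 along the second, and constant along all other axes.
   Connectedness of the punctured Whitehead graphs makes phi eventually constant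
   on each side of that edge, so both jumps equal the difference of these two
   constants: a contradiction. Hence every letter occurs exactly once in w, and
   the usual normalisation of handles of a surface word gives u_2m. *)

From HB Require Import structures.
Require Import Defs.
From mathcomp Require Import all_boot all_order all_algebra.
From mathcomp Require Import finmap zify.

Set Implicit Arguments.
Unset Strict Implicit.
Unset Printing Implicit Defensive.

Import GRing.Theory.

(** * Free groups and their automorphisms *)

Section Words.
Variable n : nat.
Implicit Types (l : letter n) (s t w : seq (letter n)).

Definition winv s := rev (map (@lflip n) s).

Lemma lflipK : involutive (@lflip n).
Proof. by case=> i b; rewrite /lflip /= negbK. Qed.

Lemma lflip_inj : injective (@lflip n).
Proof. exact: inv_inj lflipK. Qed.

Lemma lflip_neq l : (lflip l == l) = false.
Proof. by apply/eqP; case: l => i [] []. Qed.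

Lemma eq_lflip l l' : (lflip l == l') = (l == lflip l').
Proof. by rewrite -{1}(lflipK l') (inj_eq lflip_inj). Qed.

Lemma letter_eq1 l l' : (l.1 == l'.1) = (l == l') || (l == lflip l').
Proof. by case: l l' => i [] [j []]; rewrite /lflip !xpair_eqE ?andbT ?andbF ?orbF. Qed.

Lemma redrel_sym l l' : redrel (lflip l) (lflip l') = redrel l' l.
Proof. by rewrite /redrel lflipK eq_lflip eq_sym eq_lflip eq_sym. Qed.

Lemma size_winv s : size (winv s) = size s.
Proof. by rewrite size_rev size_map. Qed.

Lemma winv_cat s t : winv (s ++ t) = winv t ++ winv s.
Proof. by rewrite /winv map_cat rev_cat. Qed.

Lemma winvK : involutive winv.
Proof. by move=> s; rewrite /winv map_rev revK mapK //; apply: lflipK. Qed.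

Lemma winv_cons l s : winv (l :: s) = rcons (winv s) (lflip l).
Proof. by rewrite /winv /= rev_cons. Qed.

Lemma winv_rcons l s : winv (rcons s l) = lflip l :: winv s.
Proof. by rewrite /winv map_rcons rev_rcons. Qed.

Lemma reducedw_winv s : reducedw (winv s) = reducedw s.
Proof.
rewrite /reducedw /winv rev_sorted sorted_map.
by apply: eq_sorted => x y /=; rewrite /relpre /= redrel_sym.
Qed.

Lemma cons_red_flip l w : reducedw w -> cons_red l (cons_red (lflip l) w) = w.
Proof.
case: w => [|l' w] /=; first by rewrite eqxx.
rewrite lflipK; have [-> | ne] := eqVneq l' l; last by rewrite /= eqxx.
by case: w => [|l2 w] //= /andP[/negbTE ->].
Qed.

(** Prepending letters with [cons_red] is an action on reduced words in which [l] and [lflip l] are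
    mutually inverse, so cancelling such a pair in [s] does not change how [s] acts. Associativity
    of the product rests on this. *)
Lemma foldr_cons_red_red s w :
  reducedw w -> foldr (@cons_red n) w (red s) = foldr (@cons_red n) w s.
Proof.
move=> rw; have rf t : reducedw (foldr (@cons_red n) w t).
  by elim: t => //= l t IH; apply: cons_red_reduced.
elim: s => //= l s <-; have := red_reduced s.
case: (red s) => [|l' t] //= _; case: eqP => [->|_] //=.
by rewrite cons_red_flip.
Qed.

Lemma red_cat s t : red (s ++ t) = foldr (@cons_red n) (red t) s.
Proof. by rewrite /red foldr_cat. Qed.

Lemma red_id w : reducedw w -> red w = w.
Proof.
elim: w => //= l [|l' w] IH //= /andP[ne /IH /= ->].
by rewrite /= (negbTE ne).
Qed.

Lemma red_redl s t : red (red s ++ t) = red (s ++ t).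
Proof. by rewrite !red_cat foldr_cons_red_red // red_reduced. Qed.

Lemma red_redr s t : red (s ++ red t) = red (s ++ t).
Proof. by rewrite !red_cat (red_id (red_reduced t)). Qed.

Lemma red_winv s : red (winv s ++ s) = [::].
Proof.
elim: s => // l s IH; rewrite winv_cons cat_rcons red_cat.
have -> : red (lflip l :: l :: s) = red s.
  by rewrite -[in l :: s](lflipK l) /= cons_red_flip ?red_reduced.
by rewrite -red_cat.
Qed.

Lemma mkFGK (g : FG n) : mkFG (fgw g) = g.
Proof. by apply: val_inj; rewrite /= red_id //; case: g. Qed.

Lemma fgwK w : reducedw w -> fgw (mkFG w) = w.
Proof. exact: red_id. Qed.

Lemma fgw_reduced (g : FG n) : reducedw (fgw g).
Proof. by case: g. Qed.

Lemma mkFG_red s t : red s = red t -> mkFG s = mkFG t.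
Proof. by move=> e; apply: val_inj. Qed.

Fact fg_mulE s t : fg_mul (mkFG s) (mkFG t) = mkFG (s ++ t).
Proof. by apply: mkFG_red; rewrite /= red_redl red_redr. Qed.

Fact fg_mulA : associative (@fg_mul n).
Proof.
move=> a b c; rewrite -(mkFGK a) -(mkFGK b) -(mkFGK c) !fg_mulE.
by rewrite catA.
Qed.

Fact fg_mul1g : left_id (@fg_one n) (@fg_mul n).
Proof. by move=> a; rewrite -(mkFGK a) fg_mulE. Qed.

Fact fg_mulg1 : right_id (@fg_one n) (@fg_mul n).
Proof. by move=> a; rewrite -(mkFGK a) fg_mulE cats0. Qed.

Fact fg_mulVg : left_inverse (@fg_one n) (@fg_inv n) (@fg_mul n).
Proof.
move=> a; rewrite -[in LHS](mkFGK a) fg_mulE.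
by apply: mkFG_red; rewrite /= (red_id (fgw_reduced a)) red_winv.
Qed.

Fact fg_mulgV : right_inverse (@fg_one n) (@fg_inv n) (@fg_mul n).
Proof.
move=> a; have := red_winv (winv (fgw a)); rewrite winvK => E.
by rewrite -[in LHS](mkFGK a) fg_mulE; apply: mkFG_red; rewrite /= (red_id (fgw_reduced a)) E.
Qed.

HB.instance Definition _ := isGroup.Build (FG n) fg_mulA fg_mul1g fg_mulg1 fg_mulVg fg_mulgV.

End Words.

Section FreeGroupTheory.
Local Open Scope group_scope.
Variable n : nat.
Implicit Types (l : letter n) (s t w : seq (letter n)) (g h u v : FG n).

Lemma mkFG_cat s t : mkFG (s ++ t) = mkFG s * mkFG t :> FG n.
Proof. by rewrite -fg_mulE. Qed.

Lemma mkFG_nil : mkFG [::] = 1 :> FG n. Proof. by []. Qed.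

Lemma mkFG_winv s : mkFG (winv s) = (mkFG s)^-1 :> FG n.
Proof.
apply/esym/mulg1_eq; rewrite -mkFG_cat; apply: mkFG_red.
by rewrite -{1}(winvK s) red_winv.
Qed.

Lemma mkFG_flip l : mkFG [:: lflip l] = (mkFG [:: l])^-1 :> FG n.
Proof. by rewrite -mkFG_winv. Qed.

Lemma mkFG_cons l s : mkFG (l :: s) = mkFG [:: l] * mkFG s :> FG n.
Proof. by rewrite -mkFG_cat. Qed.

Lemma fgw_inj_red s t : reducedw s -> reducedw t -> mkFG s = mkFG t :> FG n -> s = t.
Proof. by move=> rs rt /(congr1 (@fgw n)); rewrite !fgwK. Qed.

Definition ev (f : 'I_n -> FG n) l : FG n := if l.2 then (f l.1)^-1 else f l.1.
Definition evw f s : FG n := \prod_(l <- s) ev f l.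
Definition fhom f g : FG n := evw f (fgw g).

Lemma ev_flip f l : ev f (lflip l) = (ev f l)^-1.
Proof. by case: l => i []; rewrite /ev //= invgK. Qed.

Lemma evw_cat f s t : evw f (s ++ t) = evw f s * evw f t.
Proof. exact: big_cat. Qed.

Lemma evw1 f l : evw f [:: l] = ev f l.
Proof. exact: big_seq1. Qed.

Lemma evw_red f s : evw f (red s) = evw f s.
Proof.
elim: s => //= l s IH.
rewrite -(cat1s l s) evw_cat -IH -evw_cat /=; case: (red s) => //= l' t.
case: eqP => [->|] //; rewrite -cat1s -(cat1s (lflip l)) !evw_cat !evw1 ev_flip.
by rewrite mulVKg.
Qed.

Lemma fhom_mkFG f s : fhom f (mkFG s) = evw f s.
Proof. exact: evw_red. Qed.

Lemma fhomM f : {morph fhom f : g h / g * h}.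
Proof. by move=> g h; rewrite /fhom -evw_cat [LHS]evw_red. Qed.

Lemma fhom1 f : fhom f 1 = 1. Proof. by rewrite fhom_mkFG /evw big_nil. Qed.

Lemma fhomV f g : fhom f g^-1 = (fhom f g)^-1.
Proof. by apply/esym/mulg1_eq; rewrite -fhomM mulgV fhom1. Qed.

Lemma fhom_letter f l : fhom f (mkFG [:: l]) = ev f l.
Proof. by rewrite fhom_mkFG evw1. Qed.

Lemma fhom_gen f i : fhom f (fg_gen i) = f i.
Proof. by rewrite fhom_letter. Qed.

Lemma morph_gen_id (phi : FG n -> FG n) :
  {morph phi : g h / g * h} -> (forall i, phi (fg_gen i) = fg_gen i) -> phi =1 id.
Proof.
move=> phiM phi_gen.
have phi1 : phi 1 = 1 by apply: (mulgI (phi 1)); rewrite -phiM !mulg1.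
have phiV g : phi g^-1 = (phi g)^-1 by apply/esym/mulg1_eq; rewrite -phiM mulgV.
move=> g; rewrite -(mkFGK g); elim: (fgw g) => [|[i b] s IH] //.
rewrite mkFG_cons phiM IH; congr (_ * _); case: b; last exact: phi_gen.
by rewrite -[(i, true)]/(lflip (i, false)) mkFG_flip phiV phi_gen.
Qed.

Lemma fg_aut_fhom f f' :
  (forall i, fhom f (f' i) = fg_gen i) -> (forall i, fhom f' (f i) = fg_gen i) ->
  fg_aut (fhom f).
Proof.
move=> ff' f'f; split; first exact: fhomM.
exists (fhom f'); apply: morph_gen_id => [g h|i].
- by rewrite !fhomM.
- by rewrite fhom_gen.
- by rewrite !fhomM.
- by rewrite fhom_gen.
Qed.

Definition aut_eq u v := exists2 phi, @fg_aut n phi & phi u = v.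
Local Notation "u ~ v" := (aut_eq u v) (at level 70).

Lemma aut_refl u : u ~ u.
Proof. by exists id => //; split=> //; exists id. Qed.

Lemma aut_trans v u g : u ~ v -> v ~ g -> u ~ g.
Proof.
move=> [f [fM fb] <-] [k [kM kb] <-]; exists (k \o f) => //.
by split; [move=> a b /=; rewrite fM kM | apply: bij_comp].
Qed.

Lemma aut_sym u v : u ~ v -> v ~ u.
Proof.
move=> [f [fM [g fK gK]] <-]; exists g => //; split; last by exists f.
by move=> a b; apply: (can_inj fK); rewrite fM !gK.
Qed.

Lemma aut_conj u g : u ~ g * u * g^-1.
Proof.
have cM : {morph (fun u => g * u * g^-1) : a b / a * b}.
  by move=> a b; rewrite -!mulgA mulKg.
exists (fun u => g * u * g^-1) => //; split=> //.
by exists (fun u => g^-1 * u * g) => a;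
  rewrite !mulgA ?mulgV ?mulVg ?mul1g -!mulgA ?mulgV ?mulVg mulg1.
Qed.

Lemma aut_rot s t : mkFG (s ++ t) ~ mkFG (t ++ s).
Proof.
have := aut_conj (mkFG (s ++ t)) (mkFG s)^-1.
by rewrite !mkFG_cat invgK mulKg.
Qed.

Definition avoids (T : pred 'I_n) s := all (fun l => ~~ T l.1) s.

Section Transvection.
Variables (T : pred 'I_n) (P Q : 'I_n -> seq (letter n)).
Hypothesis avT : forall i, avoids T (P i) /\ avoids T (Q i).
Hypothesis offT : forall i, ~~ T i -> P i = [::] /\ Q i = [::].

Definition transv i : FG n := mkFG (P i ++ (i, false) :: Q i).
Definition transv_inv i : FG n := mkFG (winv (P i) ++ (i, false) :: winv (Q i)).

Lemma evw_avoids f s :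
  (forall i, ~~ T i -> f i = fg_gen i) -> avoids T s -> evw f s = mkFG s.
Proof.
move=> fT; elim: s => [|[i b] s IH] /=; first by rewrite /evw big_nil.
case/andP=> Ti /IH e; rewrite mkFG_cons -e -cat1s evw_cat evw1; congr (_ * _).
by rewrite /ev /= fT //; case: b => //; rewrite -mkFG_winv.
Qed.

Lemma transv_off i : ~~ T i -> transv i = fg_gen i.
Proof. by case/offT; rewrite /transv => -> ->. Qed.

Lemma transv_inv_off i : ~~ T i -> transv_inv i = fg_gen i.
Proof. by case/offT; rewrite /transv_inv => -> ->. Qed.

Lemma avoids_winv s : avoids T (winv s) = avoids T s.
Proof. by rewrite /avoids all_rev all_map; apply: eq_all. Qed.

Lemma fhom_transv_avoid s : avoids T s -> fhom transv (mkFG s) = mkFG s.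
Proof.
by move=> av; rewrite fhom_mkFG (evw_avoids transv_off).
Qed.

(** The words [P i] and [Q i] only involve generators outside [T], which both maps fix; hence
    multiplying by the inverse words undoes the move. Whitehead automorphisms and handle moves are
    both of this form. *)
Lemma transv_aut : fg_aut (fhom transv).
Proof.
have E := mkFG_cat; have C := mkFG_cons.
apply: (@fg_aut_fhom _ transv_inv) => i.
  rewrite fhom_mkFG -cat1s !evw_cat evw1 !(evw_avoids transv_off) ?avoids_winv.
  - rewrite /ev /transv /= !mkFG_cat mkFG_cons !mkFG_winv -!mulgA mulKg.
    by rewrite mulgV mulg1.
  - by case: (avT i).
  - by case: (avT i).
rewrite fhom_mkFG -cat1s !evw_cat evw1 !(evw_avoids transv_inv_off).
- rewrite /ev /transv_inv /= !mkFG_cat mkFG_cons !mkFG_winv -!mulgA mulVKg.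
  by rewrite mulVg mulg1.
- by case: (avT i).
- by case: (avT i).
Qed.
End Transvection.

End FreeGroupTheory.

(** * Almost invariant functions *)

Section AlmostInvariant.
Local Open Scope group_scope.
Variable n : nat.
Implicit Types (g h k u v : FG n) (phi : FG n -> int).

Definition almost_invariant phi :=
  forall k, exists s : seq (FG n), forall g, g \notin s -> phi (g * k) = phi g.

(** Differences of point masses span the finitely supported functions of sum 0, so the first clause
    makes all of these coboundaries; the second keeps a point mass, of sum 1, out of the image. *)
Definition coboundary_onto u :=
  (forall h1 h2, exists2 phi, almost_invariant phi &
     forall h, (phi (h * u)%g - phi h = (h == h1)%:R - (h == h2)%:R)%R) /\
  ~ (exists2 phi, almost_invariant phi &
     forall h, (phi (h * u)%g - phi h = (h == 1%g)%:R)%R).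

(** Moving past one letter translates the exceptional set, so it stays finite along the word of [k];
    for an inverse letter the set of the generator is translated. *)
Lemma almost_invariant_gen phi :
  (forall i, exists s : seq (FG n), forall g, g \notin s -> phi (g * fg_gen i) = phi g) ->
  almost_invariant phi.
Proof.
move=> aiG.
have aiL (l : letter n) : exists s : seq (FG n),
    forall g, g \notin s -> phi (g * mkFG [:: l]) = phi g.
  case: l => i [|]; last exact: aiG.
  have [s Hs] := aiG i; exists [seq g * fg_gen i | g <- s] => g.
  rewrite -[(i, true)]/(lflip (i, false)) mkFG_flip -/(fg_gen i) => Hg.
  rewrite -{2}(mulgVK (fg_gen i) g) Hs //; apply: contra Hg => Hg.
  by apply/mapP; exists (g * (fg_gen i)^-1); rewrite ?mulgVK.
move=> k; rewrite -(mkFGK k); elim: (fgw k) => [|l w [s Hs]].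
  by exists [::] => g _; rewrite mulg1.
have [s' Hs'] := aiL l; exists ([seq g * (mkFG [:: l])^-1 | g <- s] ++ s') => g.
rewrite mem_cat negb_or => /andP[Hg1 Hg2]; rewrite mkFG_cons mulgA.
rewrite Hs ?Hs' //; apply: contra Hg1 => Hg1.
by apply/mapP; exists (g * mkFG [:: l]); rewrite ?mulgK.
Qed.

Lemma coboundary_onto_aut u v : aut_eq u v -> coboundary_onto u -> coboundary_onto v.
Proof.
move=> [f [fM [f' fK f'K]] <-] [uP uQ].
have fM' g h : f (g * h) = f g * f h by apply: fM.
have f'M g h : f' (g * h) = f' g * f' h by apply: (can_inj fK); rewrite fM' !f'K.
have f'1 : f' 1 = 1 by apply: (mulgI (f' 1)); rewrite -f'M !mulg1.
split=> [h1 h2|[phi aphi Hphi]]; last first.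
  apply: uQ; exists (phi \o f) => [k|h].
    have [s Hs] := aphi (f k); exists (map f' s) => g /= Hg.
    by rewrite fM' Hs //; apply: contra Hg => Hg; rewrite -(fK g) map_f.
  by rewrite /= fM' Hphi -(inj_eq (can_inj f'K)) fK f'1.
have [phi aphi Hphi] := uP (f' h1) (f' h2).
exists (phi \o f') => [k|h].
  have [s Hs] := aphi (f' k); exists (map f s) => g /= Hg.
  by rewrite f'M Hs //; apply: contra Hg => Hg; rewrite -(f'K g) map_f.
by rewrite /= f'M fK Hphi !(inj_eq (can_inj f'K)).
Qed.

End AlmostInvariant.

(** * The group ring, Fox derivatives and potentials *)

Section GroupRing.
Local Open Scope fset_scope.
Local Open Scope ring_scope.
Variable n : nat.
Implicit Types (g h k u v : FG n) (phi : FG n -> int) (a b : ZF n).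

Lemma zf_ofE g x : zf_of g x = (x == g)%:R.
Proof. by rewrite fsfunE in_fset1; case: eqP. Qed.

Lemma zf_addE a b x : zf_add a b x = a x + b x.
Proof.
rewrite fsfunE in_fsetU; case: ifPn => //.
by rewrite negb_or => /andP[/fsfun_dflt -> /fsfun_dflt ->].
Qed.

Lemma zf_subE a b x : zf_sub a b x = a x - b x.
Proof.
by rewrite zf_addE [X in _ + X]fsfunE; case: ifPn => // /fsfun_dflt ->; rewrite oppr0.
Qed.

Lemma zf_mulE a b x :
  zf_mul a b x = \sum_(y <- finsupp a) a y * b (fg_mul (fg_inv y) x).
Proof.
rewrite fsfunE; case: ifPn => // Hx; rewrite big_seq big1 // => y Hy.
have [Hb|Hb] := boolP (fg_mul (fg_inv y) x \in finsupp b); last first.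
  by rewrite (fsfun_dflt Hb) mulr0.
case/negP: Hx; apply/imfset2P; exists y => //; exists (fg_mul (fg_inv y) x) => //.
by apply/esym; exact: (mulVKg y x).
Qed.

Lemma zf_sumIE (A : 'I_n -> ZF n) x : zf_sumI A x = \sum_(i < n) A i x.
Proof.
apply: (big_morph (fun a : ZF n => a x) (fun a b => zf_addE a b x)).
by rewrite fsfunE.
Qed.

(** The linear extension of [phi] to the group ring, evaluated at [a]; the augmentation is the case
    of the constant 1. *)
Definition zpair a phi : int := \sum_(g <- finsupp a) a g * phi g.

Lemma zpair_widen (S : {fset FG n}) a phi :
  finsupp a `<=` S -> zpair a phi = \sum_(g <- S) a g * phi g.
Proof.
move=> sub; apply: big_fset_incl => // g _ /fsfun_dflt ->.
by rewrite mul0r.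
Qed.

Lemma zpair_add a b phi : zpair (zf_add a b) phi = zpair a phi + zpair b phi.
Proof.
set S := finsupp a `|` finsupp b `|` finsupp (zf_add a b).
have Sab : finsupp (zf_add a b) `<=` S by apply: fsubsetUr.
have Sa : finsupp a `<=` S by rewrite /S -fsetUA fsubsetUl.
have Sb : finsupp b `<=` S by rewrite /S fsetUAC fsubsetUr.
rewrite (zpair_widen _ Sab) (zpair_widen _ Sa) (zpair_widen _ Sb).
by rewrite -big_split; apply: eq_bigr => g _; rewrite zf_addE mulrDl.
Qed.

Lemma zpair_sub a b phi : zpair (zf_sub a b) phi = zpair a phi - zpair b phi.
Proof.
apply: (addIr (zpair b phi)); rewrite -zpair_add subrK.
have -> // : zf_add (zf_sub a b) b = a.
by apply/fsfunP => x; rewrite zf_addE zf_subE subrK.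
Qed.

Lemma zpair_of g phi : zpair (zf_of g) phi = phi g.
Proof.
rewrite (@zpair_widen [fset g]) ?big_seq_fset1 ?zf_ofE ?eqxx ?mul1r //.
apply/fsubsetP => x; rewrite mem_finsupp zf_ofE in_fset1.
by case: (x == g); rewrite ?eqxx.
Qed.

Lemma zpair_sumI (A : 'I_n -> ZF n) phi :
  zpair (zf_sumI A) phi = \sum_(i < n) zpair (A i) phi.
Proof.
apply: (big_morph (fun a : ZF n => zpair a phi) (fun a b => zpair_add a b phi)).
rewrite /zpair big_seq big1 // => g; by rewrite fsfunE mul0r.
Qed.

Lemma zpair_mul a b phi :
  zpair (zf_mul a b) phi = \sum_(g <- finsupp a) a g * zpair b (fun h => phi (fg_mul g h)).
Proof.
pose T := [fset fg_mul y z | y in finsupp a, z in finsupp b].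
have sT : finsupp (zf_mul a b) `<=` T by apply: finsupp_sub.
rewrite (zpair_widen _ sT).
under eq_bigr => x _ do rewrite zf_mulE mulr_suml.
rewrite exchange_big /=; apply: eq_big_seq => y Hy.
under eq_bigr => x _ do rewrite -mulrA.
rewrite -mulr_sumr; congr (_ * _).
transitivity (\sum_(x <- [fset fg_mul y z | z in finsupp b]) b (fg_mul (fg_inv y) x) * phi x).
  apply/esym/big_fset_incl.
    apply/fsubsetP => x /imfsetP[z /= Hz ->]; apply/imfset2P.
    by exists y => //; exists z.
  move=> x _ Hx; rewrite (fsfun_dflt (k := fg_mul _ _)) ?mul0r //.
  apply: contra Hx => Hx; apply/imfsetP; exists (fg_mul (fg_inv y) x) => //.
  by apply/esym; exact: (mulVKg y x).
rewrite big_imfset /=; last by move=> z z' _ _; apply: (@mulgI _ y).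
apply: eq_bigr => z _.
by have -> : fg_mul (fg_inv y) (fg_mul y z) = z by exact: mulKg.
Qed.

Lemma zf_augE a : zf_aug a = zpair a (fun=> 1).
Proof. by apply: eq_bigr => g _; rewrite mulr1. Qed.

Lemma zf_aug_sum_mul (D r : 'I_n -> ZF n) : (forall i, zf_aug (D i) = 0) ->
  zf_aug (zf_sumI (fun i => zf_mul (D i) (r i))) = 0.
Proof.
move=> D0; rewrite zf_augE zpair_sumI big1 // => i _.
by rewrite zpair_mul -mulr_suml -/(zf_aug _) D0 mul0r.
Qed.

(** Extend g |-> phi(hg) linearly and apply it to u - 1 = sum_i D_i (x_i - 1). A term g (x_i - 1)
    contributes phi(h g x_i) - phi(h g) = r_i(g^-1 h^-1), which is the factor at [g] in the
    coefficient of D_i r_i at h^-1; this is why inverses appear. *)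
Lemma coboundary_fox u (D r : 'I_n -> ZF n) phi :
  fox_derivs u D ->
  (forall i g, phi (g * fg_gen i)%g - phi g = r i (g^-1)%g) ->
  forall h, phi (h * u)%g - phi h = zf_sumI (fun i => zf_mul (D i) (r i)) (h^-1)%g.
Proof.
move=> fox Hr h.
have -> : phi (h * u)%g - phi h = zpair (zf_sub (zf_of u) (zf_one n)) (fun g => phi (h * g)%g).
  by rewrite zpair_sub !zpair_of [in X in _ = _ - X]mulg1.
rewrite fox zpair_sumI zf_sumIE; apply: eq_bigr => i _.
rewrite zpair_mul zf_mulE; apply: eq_bigr => g _; congr (_ * _).
rewrite zpair_sub !zpair_of -[fg_mul g (fg_gen i)]/(g * fg_gen i)%g.
have -> : fg_mul g (fg_one n) = g by exact: mulg1.
rewrite mulgA Hr.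
by rewrite invgM.
Qed.

Section Potential.
Variable r : 'I_n -> ZF n.

(** The increment along the Cayley edge from g to gl forced by phi(g x_i) - phi(g) = r_i(g^-1); an
    inverse letter traverses an edge backwards, hence the sign. *)
Definition jump g (l : letter n) : int :=
  if l.2 then - r l.1 (g * mkFG [:: l])^-1%g else r l.1 g^-1%g.

Fixpoint potential g (w : seq (letter n)) : int :=
  if w is l :: w' then jump g l + potential (g * mkFG [:: l])%g w' else 0.

Lemma jump_flip g l : jump g l + jump (g * mkFG [:: l])%g (lflip l) = 0.
Proof.
case: l => i []; rewrite /jump /=; last first.
  by rewrite mkFG_flip mulgK subrr.
by rewrite addNr.
Qed.

(** Backtracking along an edge contributes 0 by [jump_flip], so the sum along a path depends only on
    its end points: the Cayley graph is a tree. *)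
Lemma potential_red g w : potential g (red w) = potential g w.
Proof.
elim: w g => //= l w IH g; rewrite -IH; case: (red w) => [|l' t] //=.
case: eqP => [->|] //=.
by rewrite addrA jump_flip add0r mkFG_flip mulgK.
Qed.

Lemma potential_rcons g w l :
  potential g (rcons w l) = potential g w + jump (g * mkFG w)%g l.
Proof.
elim: w g => /= [|l' w IH] g; first by rewrite mkFG_nil mulg1 addr0 add0r.
by rewrite IH addrA (mkFG_cons l' w) mulgA.
Qed.

Lemma potential_gen i g :
  potential 1%g (fgw (g * fg_gen i)%g) - potential 1%g (fgw g) = r i g^-1%g.
Proof.
rewrite -{1}(mkFGK g) -mkFG_cat [fgw _]/(red _) potential_red cats1 potential_rcons.
by rewrite addrC addKr mul1g mkFGK.
Qed.
End Potential.

(** Integrating the coefficients [r] gives the function for the first clause. For the second, a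
    solution would give sum_i D_i r_i = 1, whereas all D_i have augmentation 0. *)
Lemma Delta_primitive_coboundary u : Delta_primitive u -> coboundary_onto u.
Proof.
move=> [D [fox [D0 Dgen]]]; split=> [h1 h2|[phi aphi Hphi]].
  (* Inverses are taken because [coboundary_fox] reads coefficients at h^-1. *)
  pose a := zf_sub (zf_of h1^-1%g) (zf_of h2^-1%g).
  have [|r Hr] := Dgen a; first by rewrite zf_augE zpair_sub !zpair_of subrr.
  exists (fun g => potential r 1%g (fgw g)).
    apply: almost_invariant_gen => i; exists [seq g^-1%g | g <- finsupp (r i)] => g Hg.
    apply/eqP; rewrite -subr_eq0 potential_gen fsfun_dflt //; apply: contra Hg => Hg.
    by apply/mapP; exists g^-1%g; rewrite ?invgK.
  move=> h; rewrite (coboundary_fox (phi := fun g => potential r 1%g (fgw g)) fox (potential_gen r)).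
  by rewrite -Hr zf_subE !zf_ofE !(inj_eq invg_inj).
have [r Hr] : exists r : 'I_n -> ZF n, forall i g, phi (g * fg_gen i)%g - phi g = r i g^-1%g.
  have F i : exists s : seq (FG n), forall g, g \notin s -> phi (g * fg_gen i)%g = phi g.
    exact: aphi.
  have {}F i : exists ri : ZF n, forall g, phi (g * fg_gen i)%g - phi g = ri g^-1%g.
    have [s Hs] := F i.
    exists [fsfun x in [fset x | x in [seq g^-1%g | g <- s]] =>
              (phi (x^-1 * fg_gen i)%g - phi x^-1%g) | 0] => g.
    rewrite fsfunE inE invgK; case: ifPn => //= Hg.
    rewrite Hs ?subrr //; apply: contra Hg => Hg.
    by apply/mapP; exists g.
  by have [r Hr] := fin_all_exists F; exists r.
pose A := zf_sumI (fun i => zf_mul (D i) (r i)).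
have EA : A = zf_one n.
  apply/fsfunP => x; rewrite -(invgK x) -(coboundary_fox fox Hr) Hphi zf_ofE.
  by rewrite -(inj_eq invg_inj) invg1.
by have := zf_aug_sum_mul r D0; rewrite -/A EA zf_augE zpair_of.
Qed.

End GroupRing.

Lemma count_cons (T : Type) (a : pred T) x s : count a (x :: s) = a x + count a s.
Proof. by []. Qed.

(** * Cyclic words *)

Section Cycles.
Variables (T : eqType) (e : rel T).
Implicit Types (x y : T) (s t w : seq T).

Lemma path_split x w :
  (forall s y t, w = s ++ y :: t -> e (last x s) y) -> path e x w.
Proof.
elim: w x => //= y w IH x H; rewrite (H [::] y w) //=; apply: IH => s z t E.
by apply: (H (y :: s) z t); rewrite E.
Qed.

Lemma cycle_split w :
  (forall s y t, w = s ++ y :: t -> e (last y (t ++ s)) y) -> cycle e w.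
Proof.
case: w => //= x p H; apply: path_split => s y t.
case/lastP: t => [|t z]; rewrite ?cats1.
  by move/rcons_inj=> [<- <-]; have := H [::] x p erefl; rewrite cats0.
rewrite -rcons_cons -rcons_cat => /rcons_inj[E _].
by have := H (x :: s) y t; rewrite E last_cat /= => ->.
Qed.

Lemma cycle_cat_rot s t : cycle e (s ++ t) = cycle e (t ++ s).
Proof. by rewrite -(rot_cycle (size s)) rot_size_cat. Qed.

Lemma cycle_turn w s y t : cycle e w -> w = s ++ y :: t -> e (last y (t ++ s)) y.
Proof. by move=> cw E; move: cw; rewrite E cycle_cat_rot /= rcons_path => /andP[]. Qed.

Lemma cycle_next w s y t : cycle e w -> w = s ++ y :: t -> e y (head y (t ++ s)).
Proof.
move=> cw E; move: cw; rewrite E cycle_cat_rot /=.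
by case: (t ++ s) => [|z r] /= => /andP[].
Qed.

Lemma cycle_splitN w :
  ~~ cycle e w -> exists s y t, w = s ++ y :: t /\ ~~ e (last y (t ++ s)) y.
Proof.
case: w => // x p; rewrite /= rcons_path negb_and.
have [px|] := boolP (path e x p) => /= H.
  by exists [::], x, p; rewrite cats0.
move=> _; suff: exists s y t, p = s ++ y :: t /\ ~~ e (last x s) y.
  case=> s [y [t [-> ne]]]; exists (x :: s), y, t; split=> //.
  by rewrite last_cat.
elim: p x H => //= y p IH x; rewrite negb_and; have [exy /= /IH|nexy _] := boolP (e x y).
  by case=> s [z [t [-> ne]]]; exists (y :: s), z, t.
by exists [::], y, p.
Qed.

Lemma sorted_cycle_flatten w k : cycle e w -> sorted e (flatten (nseq k w)).
Proof.
case: w => [|x p] /=; first by elim: k.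
rewrite rcons_path => /andP[px lx]; case: k => //= k.
by elim: k => [|k IH] /=; rewrite cat_path px //= lx.
Qed.

End Cycles.

Lemma cycle_and (T : Type) (e e' : rel T) w :
  cycle (fun x y => e x y && e' x y) w = cycle e w && cycle e' w.
Proof.
case: w => //= x p; move: (rcons p x) => q.
by elim: q x => //= y q IH x; rewrite IH andbACA.
Qed.

Lemma cycle_const (T U : eqType) (f : T -> U) w x y :
  cycle (fun x y => f x == f y) w -> x \in w -> y \in w -> f x = f y.
Proof.
case: w => // z p /=; rewrite rcons_path => /andP[pz _].
suff H q : q \in z :: p -> f q = f z by move=> /H-> /H->.
elim: p z pz => [|r p IH] z /=; first by rewrite inE => _ /eqP->.
case/andP=> /eqP zr /IH H; rewrite inE => /orP[/eqP->//|/H ->].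
by rewrite zr.
Qed.

Lemma cycle_mem (T : eqType) (e : rel T) w y :
  cycle e w -> y \in w -> (exists x, e x y) /\ (exists z, e y z).
Proof.
move=> cw /splitPr yw; case: yw cw => s t cw; split.
  by exists (last y (t ++ s)); apply: (cycle_turn cw).
by exists (head y (t ++ s)); apply: (cycle_next cw).
Qed.

(** * Every generator occurs *)

Section Occurrence.
Local Open Scope group_scope.
Variable n : nat.
Implicit Types (l : letter n) (s t w : seq (letter n)) (g h u v : FG n).

Lemma reducedw_rcons s x l :
  reducedw (rcons (rcons s x) l) = reducedw (rcons s x) && (x != lflip l).
Proof.
rewrite /reducedw; case: s => [|y s] /=; first by rewrite andbT /redrel eq_sym eq_lflip.
by rewrite rcons_path last_rcons /redrel eq_sym eq_lflip.
Qed.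

Lemma fgw_mul_letter g l :
  (exists2 s, fgw g = rcons s (lflip l) & fgw (g * mkFG [:: l]) = s) \/
  fgw (g * mkFG [:: l]) = rcons (fgw g) l.
Proof.
have rg := fgw_reduced g; rewrite -{2 3}(mkFGK g) -mkFG_cat.
case/lastP E: (fgw g) rg => [|s x] rg; first by right.
have [xl|xl] := eqVneq x (lflip l); [left|right]; last first.
  by rewrite cats1 fgwK // reducedw_rcons rg.
exists s; first by rewrite xl.
have rs : reducedw s by move: rg; rewrite /reducedw -cats1 => /cat_sorted2[].
apply: etrans (fgwK rs); congr fgw.
rewrite xl -cats1 -catA /= mkFG_cat mkFG_cons mkFG_flip mulVg mulg1 //.
Qed.

Section Retraction.
Variable i : 'I_n.
Let hasi (l : letter n) := l.1 == i.
(** On reduced words this is the nearest-point retraction of the Cayley tree onto the subtree of the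
    subgroup generated by the other generators. *)
Let retr s := take (find hasi s) s.

Lemma retr_id s : ~~ has hasi s -> retr s = s.
Proof. by move=> /hasNfind; rewrite /retr => ->; rewrite take_size. Qed.

Lemma retr_rcons s l : has hasi s || hasi l -> retr (rcons s l) = retr s.
Proof.
rewrite /retr -cats1 find_cat; case: ifPn => [hs _|hs /= hl].
  by rewrite takel_cat // find_size.
by rewrite hl addn0 take_size_cat // hasNfind // take_size.
Qed.

(** If no letter of [w] involves x_i, then [w] lies in the subgroup H generated by the other
    generators. Precompose a solution for the point masses at 1 and x_i with the retraction onto H:
    off H the composite is constant along [w], so only the mass at 1 survives, against the second
    clause of [coboundary_onto]. *)
Lemma occurs w : coboundary_onto (mkFG w) -> has hasi w.
Proof.
case=> uP uQ; apply: contraT => nw; case: uQ.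
have [phi aphi Hphi] := uP 1 (fg_gen i).
pose rho g := mkFG (retr (fgw g)).
have rho_off g l : has hasi (fgw g) || hasi l -> rho (g * mkFG [:: l]) = rho g.
  case: (fgw_mul_letter g l) => [[s E1 E2]|E] hil; rewrite /rho ?E ?retr_rcons //.
  rewrite E1 E2 retr_rcons //; move: hil; rewrite E1 has_rcons /= {2}/hasi /=.
  by rewrite -/(hasi l) orbC orbA orbb orbC.
have has_mul g l : ~~ hasi l -> has hasi (fgw (g * mkFG [:: l])) = has hasi (fgw g).
  move=> /negbTE hl; case: (fgw_mul_letter g l) => [[s -> ->]|->].
    by rewrite has_rcons {2}/hasi /= -/(hasi l) hl.
  by rewrite has_rcons hl.
have rho_on g : ~~ has hasi (fgw g) -> rho g = g.
  by move=> ng; rewrite /rho retr_id // mkFGK.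
have has_w g : has hasi (fgw (g * mkFG w)) = has hasi (fgw g).
  elim: (w) nw g => [_ g|l t IH]; first by rewrite mulg1.
  by rewrite [has _ _]/= negb_or => /andP[hl /IH e] g; rewrite mkFG_cons mulgA e has_mul.
have rho_w g : has hasi (fgw g) -> rho (g * mkFG w) = rho g.
  elim: (w) nw g => [_ g|l t IH]; first by rewrite mulg1.
  rewrite [has _ _]/= negb_or => /andP[hl /IH e] g hg; rewrite mkFG_cons mulgA e ?has_mul //.
  by rewrite rho_off // hg.
exists (phi \o rho) => [|h] /=.
  apply: almost_invariant_gen => j; have [s Hs] := aphi (fg_gen j).
  exists s => g /Hs E /=.
  case: (boolP (has hasi (fgw g) || hasi (j, false))) => [/rho_off -> //|].
  rewrite negb_or => /andP[hg hj].
  by rewrite !rho_on ?has_mul.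
have [hh|hh] := boolP (has hasi (fgw h)).
  rewrite rho_w // subrr; case: eqP hh => // ->.
  by have -> : fgw (1 : FG n) = [::] by [].
rewrite !rho_on ?has_w // Hphi; case: eqP hh => [->|_]; case: eqP => //.
by move=> ->; rewrite /= /hasi eqxx.
Qed.

End Retraction.

Lemma occurs_letter w l : coboundary_onto (mkFG w) -> (l \in w) || (lflip l \in w).
Proof.
move=> /occurs-/(_ l.1) /hasP[l' l'w]; rewrite letter_eq1.
by case/orP=> /eqP <-; rewrite l'w ?orbT.
Qed.

End Occurrence.

(** * Whitehead graphs and shortening *)

Section Whitehead.
Local Open Scope group_scope.
Variable n : nat.
Implicit Types (l x y a c : letter n) (s t w : seq (letter n)) (Y : {set letter n}).
Local Notation "u ~ v" := (aut_eq u v) (at level 70).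

(* A pair x y of cyclically consecutive letters of a word is the edge joining
   x^-1 and y in its Whitehead graph; wclosed c Y w says that no edge avoiding
   the vertex c joins Y to its complement. *)
Definition wclosed c Y w :=
  cycle (fun x y => [|| lflip x == c, y == c | (lflip x \in Y) == (y \in Y)]) w.

Definition no_cut_vertex w :=
  [forall c, forall Y : {set letter n},
     (c \notin Y) ==> wclosed c Y w ==> ((Y == set0) || (Y == ~: [set c]))].

Section Move.
Variables (a : letter n) (Y : {set letter n}).
Hypotheses (aY : a \notin Y) (aVY : lflip a \notin Y).

Let good x y := [|| lflip x == a, y == a | (lflip x \in Y) == (y \in Y)].
(** In the Whitehead graph, the edge of the pair joins [a] to a vertex of [Y]. *)
Let cut x y := ((y == a) && (lflip x \in Y)) || ((x == lflip a) && (y \in Y)).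
Let P i := if (i, false) \in Y then [:: a] else [::].
Let Q i := if (i, true) \in Y then [:: lflip a] else [::].
Let A b : FG n := if b then mkFG [:: a] else 1.
Let alpha x y := A ((lflip x \in Y) || (y \in Y)).
Let T i := i != a.1.

Lemma whitehead_avoids i : avoids T (P i) /\ avoids T (Q i).
Proof. by rewrite /P /Q; do 2!case: ifP => _; rewrite /avoids /= /T ?eqxx. Qed.

Lemma whitehead_off i : ~~ T i -> P i = [::] /\ Q i = [::].
Proof.
rewrite negbK => /eqP ->; have: ((a.1, false) \notin Y) && ((a.1, true) \notin Y).
  by case: (a) aY aVY => j [] /= H1 H2; apply/andP.
by case/andP=> /negbTE H1 /negbTE H2; rewrite /P /Q H1 H2.
Qed.

Lemma whitehead_letter l :
  ev (transv P Q) l = A (l \in Y) * mkFG [:: l] * (A (lflip l \in Y))^-1.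
Proof.
have E i : transv P Q i = A ((i, false) \in Y) * mkFG [:: (i, false)] * (A ((i, true) \in Y))^-1.
  rewrite /transv mkFG_cat mkFG_cons /P /Q /A mulgA; congr (_ * _ * _).
    by case: ifP.
  by case: ifP => _; rewrite ?invg1 // mkFG_flip.
case: l => i [] /=; rewrite /ev /= E // !invgM invgK mulgA; congr (_ * _ * _).
Qed.

(** The Whitehead automorphism puts [a] in front of [l] if [l] is in [Y], and a^-1 behind it if l^-1
    is. By [good], these factors can be charged to the edges on either side of [l]: [alpha] is [a]
    for an edge meeting [Y]. What remains is [l], or nothing when [l] is [a] or its inverse and its
    edge at [a] leads to [Y]. *)
Lemma whitehead_step x l y : good x l -> good l y ->
  exists2 g, (size g <= ~~ ((l == a) && cut x l || (l == lflip a) && cut l y)) &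
    ev (transv P Q) l = alpha x l * mkFG g * (alpha l y)^-1.
Proof.
rewrite whitehead_letter /good /cut /alpha => gx gy.
have na : a == lflip a = false by rewrite eq_sym lflip_neq.
have [la|la] := eqVneq l a.
  have -> : (y \in Y) = false.
    move: gy; rewrite la lflip_neq (negbTE aVY) /= => /orP[/eqP ->|/eqP <-] //.
    exact: negbTE.
  rewrite la ?eqxx ?na (negbTE aY) (negbTE aVY) /= !orbF.
  have [xY|xY] := boolP (lflip x \in Y).
    by exists [::] => //; rewrite /A mkFG_nil invg1 !mulg1 mul1g.
  by exists [:: a]; rewrite /= ?andbF.
have [lVa|lVa] := eqVneq l (lflip a).
  have -> : (lflip x \in Y) = false.
    move: gx; rewrite lVa lflip_neq (negbTE aVY) /= => /orP[/eqP ->|/eqP ->] //.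
    exact: negbTE.
  rewrite lVa ?lflipK ?eqxx ?lflip_neq (negbTE aY) (negbTE aVY) /=.
  have [yY|yY] := boolP (y \in Y).
    by exists [::] => //; rewrite /A mkFG_nil mulg1 !mul1g invg1 mulg1 mkFG_flip.
  by exists [:: lflip a]; rewrite /= ?andbF.
exists [:: l] => //; congr (A _ * _ * (A _)^-1).
  move: gx; rewrite (negbTE la) /= => /orP[/eqP ->|/eqP ->].
    by rewrite (negbTE aY).
  by rewrite orbb.
move: gy; rewrite eq_lflip (negbTE lVa) /= => /orP[/eqP ->|/eqP ->].
  by rewrite (negbTE aY) orbF.
by rewrite orbb.
Qed.

(** The factors [alpha] of consecutive letters telescope. *)
Lemma whitehead_path x w y : path good x (rcons w y) ->
  exists2 g, (size g <= size w) &
    evw (transv P Q) w = alpha x (head y w) * mkFG g * (alpha (last x w) y)^-1.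
Proof.
elim: w x => [|l w IH] x /=.
  by exists [::] => //; rewrite /evw big_nil mkFG_nil mulg1 mulgV.
case/andP=> gx gw.
have gl : good l (head y w) by move: gw; case: (w) => [|z t] /= /andP[].
have [g1 s1 E1] := whitehead_step gx gl; have [g2 s2 E2] := IH _ gw.
exists (g1 ++ g2).
  rewrite size_cat; apply: (@leq_add _ _ 1) => //; apply: leq_trans s1 _.
  by case: (~~ _).
by rewrite -cat1s evw_cat evw1 E1 E2 mkFG_cat !mulgA mulgVK.
Qed.

(** Around the cycle the two outer factors [alpha] coincide, so the image is conjugate to a word
    that has lost [l]. *)
Lemma whitehead_first l w : cycle good (l :: w) ->
  ((l == a) && cut (last l w) l || (l == lflip a) && cut l (head l w)) ->
  exists2 w', size w' < size (l :: w) & mkFG (l :: w) ~ mkFG w'.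
Proof.
rewrite /= => gw sp.
have gx : good (last l w) l by move: gw; rewrite rcons_path => /andP[].
have gl : good l (head l w) by move: gw; case: (w) => [|z t] /= /andP[].
have [g1 s1 E1] := whitehead_step gx gl; have [g2 s2 E2] := whitehead_path gw.
rewrite sp leqn0 size_eq0 in s1.
exists g2; first by rewrite ltnS.
apply: (@aut_trans _ (evw (transv P Q) (l :: w))).
  exists (fhom (transv P Q)); last exact: fhom_mkFG.
  exact: transv_aut whitehead_avoids whitehead_off.
apply: aut_sym.
suff -> : evw (transv P Q) (l :: w) =
    alpha (last l w) l * mkFG g2 * (alpha (last l w) l)^-1 by apply: aut_conj.
rewrite -cat1s evw_cat evw1 E1 E2 (eqP s1) mkFG_nil mulg1 !mulgA mulgVK.
by [].
Qed.

(** A pair satisfying [cut] contains [a] or its inverse; rotating this letter to the front lets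
    [whitehead_first] delete it. *)
Lemma whitehead_shorten w : wclosed a Y w -> ~~ cycle (fun x y => ~~ cut x y) w ->
  exists2 w', size w' < size w & mkFG w ~ mkFG w'.
Proof.
move=> gw /cycle_splitN[s [y [t [E]]]]; rewrite negbK => cxy.
rewrite /wclosed E in gw *.
rewrite cycle_cat_rot /= in gw.
suff [w' sw' aw] : exists2 w', size w' < size (y :: t ++ s) & mkFG (y :: t ++ s) ~ mkFG w'.
  exists w'; first by move: sw'; rewrite /= !size_cat /= addnS addnC.
  exact: (aut_trans (aut_rot s (y :: t))).
case: (boolP (y == a)) => ya; first by apply: whitehead_first => //; rewrite ya cxy.
have lx : last y (t ++ s) == lflip a by move: cxy; rewrite /cut (negbTE ya) => /andP[].
case/lastP: (t ++ s) gw cxy lx => [|r x] /=.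
  by move=> _; rewrite /cut => + /eqP Ey; rewrite Ey lflip_neq (negbTE aVY) andbF.
rewrite last_rcons => gw cxy lx.
have [|| w' sw' aw] := @whitehead_first x (y :: r).
- by rewrite -[x :: _]/([:: x] ++ y :: r) cycle_cat_rot cats1.
- by rewrite /= cxy lx orbT.
exists w'; first by move: sw'; rewrite /= size_rcons.
by rewrite -rcons_cons -cats1; exact: (aut_trans (aut_rot (y :: r) [:: x])).
Qed.

End Move.
End Whitehead.

Section Reduction.
Local Open Scope group_scope.
Variable n : nat.
Implicit Types (l x y a c : letter n) (s t w : seq (letter n)) (Y : {set letter n}).
Local Notation "u ~ v" := (aut_eq u v) (at level 70).

(** Use [y] as cut vertex, with the rest of [Y] as one side. If no edge joined the two, [y] would be
    isolated: its edges stay in [Y], and cyclic reducedness excludes loops. Then neither [y] nor its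
    inverse would occur in [w], against [occurs_letter]. *)
Lemma shorten_isolated w Y y :
  cycle (@redrel n) w -> coboundary_onto (mkFG w) ->
  cycle (fun x y => (lflip x \in Y) == (y \in Y)) w ->
  y \in Y -> lflip y \notin Y ->
  exists2 w', size w' < size w & mkFG w ~ mkFG w'.
Proof.
move=> redw ontow YE yY yVY.
apply: (@whitehead_shorten _ y (Y :\ y)).
- by rewrite !inE eqxx.
- by rewrite !inE (negbTE yVY) andbF.
- apply: sub_cycle YE => x z /eqP E; rewrite !inE E.
  by do 2!case: (_ == y) => //=.
apply/negP => ncut.
have /sub_cycle F : subrel (fun x z => redrel x z && (((lflip x \in Y) == (z \in Y)) &&
    ~~ ((z == y) && (lflip x \in Y :\ y) || (x == lflip y) && (z \in Y :\ y))))
    (fun x z => (z != y) && (x != lflip y)).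
  move=> x z /and3P[xz /eqP E nc]; apply/andP; split; apply: contraNneq nc.
    by move=> zy; rewrite zy eqxx !inE E zy yY andbT eq_sym -zy [_ == _](negbTE xz).
  move=> xy; rewrite xy eqxx !inE -E xy lflipK yY !andbT /=.
  by apply/orP; right; move: xz; rewrite /redrel xy lflipK.
have {}F : cycle (fun x z => (z != y) && (x != lflip y)) w.
  by apply: F; rewrite !cycle_and redw YE.
have /orP[yw|yw] := occurs_letter y ontow.
  by have [[x /andP[]]] := cycle_mem F yw; rewrite eqxx.
by have [_ [x /andP[_]]] := cycle_mem F yw; rewrite eqxx.
Qed.

Lemma shorten_or_no_cut w :
  cycle (@redrel n) w -> coboundary_onto (mkFG w) ->
  no_cut_vertex w \/ exists2 w', size w' < size w & mkFG w ~ mkFG w'.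
Proof.
move=> redw ontow; have [|ncv] := boolP (no_cut_vertex w); [by left|right].
have [c [Y [cY cVY Y0 wY]]] : exists c Y,
    [/\ c \notin Y, lflip c \notin Y, Y != set0 & wclosed c Y w].
  move: ncv; rewrite negb_forall => /existsP[c]; rewrite negb_forall => /existsP[Y].
  rewrite !negb_imply negb_or => /and4P[cY wY Y0 Yc].
  have [cVY|cVY] := boolP (lflip c \in Y); last by exists c, Y.
  (* Pass to the other side of the cut, which does not contain c^-1. *)
  exists c, (~: (c |: Y)); split; rewrite ?inE ?eqxx ?cVY ?orbT //.
    apply: contra Yc => /eqP; move/(congr1 (fun X => ~: X)); rewrite setCK setC0 => E.
    apply/eqP/setP => z; have : z \in c |: Y by rewrite E inE.
    rewrite !inE; case: eqP => [->|] //=; first by rewrite (negbTE cY).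
  apply: sub_cycle wY => x y /or3P[->|->|/eqP E] //; rewrite ?orbT // !inE E.
  by do 2!case: (_ == c) => //=; rewrite eqxx.
(* If some edge joins [c] to [Y], the Whitehead move shortens [w]; otherwise [Y] is a union of
   components of the whole graph. *)
have [sp|] := boolP (cycle (fun x y => ~~ ((y == c) && (lflip x \in Y) || (x == lflip c) && (y \in Y))) w);
  last by apply: whitehead_shorten.
have YE : cycle (fun x y => (lflip x \in Y) == (y \in Y)) w.
  have := conj wY sp; move/andP; rewrite -cycle_and; apply: sub_cycle => x y.
  case/andP=> /or3P[/eqP xc|/eqP ->|//].
    rewrite xc (negbTE cY) -xc lflipK eqxx /= negb_or => /andP[_].
    by move/negbTE ->.
  by rewrite eqxx (negbTE cY) negb_or /= => /andP[/negbTE ->].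
have [/existsP[y /andP[yY yVY]]|/existsPn YV] := boolP [exists y, (y \in Y) && (lflip y \notin Y)].
  exact: shorten_isolated YE yY yVY.
have {}YV y : (lflip y \in Y) = (y \in Y).
  apply/idP/idP => H.
    by have := YV (lflip y); rewrite H lflipK /= negbK.
  by have := YV y; rewrite H /= negbK.
have /set0Pn[y yY] := Y0.
(* Now [Y] is stable under inversion, so consecutive letters are both in [Y] or both outside,
   although [y] and [c] both occur up to inversion. *)
have cst : cycle (fun x y => (x \in Y) == (y \in Y)) w.
  by apply: sub_cycle YE => x z; rewrite YV.
have /orP[cw|cw] := occurs_letter c ontow; have /orP[yw|yw] := occurs_letter y ontow;
  by have := cycle_const cst cw yw; rewrite ?YV (negbTE cY) yY.
Qed.

Lemma mkFG_cancel s l t : mkFG (s ++ l :: lflip l :: t) = mkFG (s ++ t) :> FG n.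
Proof.
by rewrite !mkFG_cat mkFG_cons (mkFG_cons (lflip l)) mkFG_flip mulVKg.
Qed.

Lemma shorten_or_cycred w : cycle (@redrel n) w \/
  exists2 w', size w' < size w & mkFG w ~ mkFG w'.
Proof.
have [|nc] := boolP (cycle (@redrel n) w); [by left|right].
have [s [y [t [E]]]] := cycle_splitN nc; rewrite negbK => /eqP yE.
have [r Er] : exists r, t ++ s = rcons r (lflip y).
  case/lastP: (t ++ s) yE => [/= /esym/eqP|r x]; first by rewrite lflip_neq.
  by rewrite last_rcons => ->; exists r; rewrite lflipK.
exists r.
  have := congr1 size Er; rewrite size_rcons size_cat E size_cat /= addnS addnC => ->.
  by rewrite ltnS leqnSn.
apply: (@aut_trans _ (mkFG (y :: t ++ s))); first by rewrite E; apply: (aut_rot s (y :: t)).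
rewrite Er -cats1 -cat_cons; apply: (aut_trans (aut_rot _ _)) => /=.
have := mkFG_cancel [::] (lflip y) r; rewrite lflipK /= => ->; exact: aut_refl.
Qed.

Lemma no_cut_representative v : coboundary_onto v ->
  exists w, [/\ v ~ mkFG w, cycle (@redrel n) w & no_cut_vertex w].
Proof.
move=> ontov; have: exists w, v ~ mkFG w by exists (fgw v); rewrite mkFGK; apply: aut_refl.
case=> w; have [k] := ubnP (size w); elim: k w => // k IH w kw vw.
have shrink : (exists2 w', size w' < size w & mkFG w ~ mkFG w') ->
    exists w, [/\ v ~ mkFG w, cycle (@redrel n) w & no_cut_vertex w].
  case=> w' sw ww'; apply: (IH w'); first by apply: leq_trans sw _.
  exact: aut_trans vw ww'.
have [cw|/shrink//] := shorten_or_cycred w.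
have [|ncw|/shrink//] := @shorten_or_no_cut w cw; last by exists w.
exact: coboundary_onto_aut vw ontov.
Qed.

End Reduction.

(** * The Cayley tree *)

Section Powers.
Local Open Scope group_scope.
Variable n : nat.
Implicit Types (l x y p q : letter n) (s t v w : seq (letter n)) (g h : FG n).

Definition wpow w k := flatten (nseq k w).

Lemma wpowS w k : wpow w k.+1 = w ++ wpow w k. Proof. by []. Qed.

Lemma wpowSr w k : wpow w k.+1 = wpow w k ++ w.
Proof. by elim: k => [|k IH]; rewrite wpowS ?cats0 // IH catA -wpowS -IH. Qed.

Lemma size_wpow w k : size (wpow w k) = (k * size w)%N.
Proof. by elim: k => //= k IH; rewrite wpowS size_cat IH mulSn. Qed.

Lemma mkFG_wpow w k : mkFG (wpow w k) = mkFG w ^+ k.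
Proof. by elim: k => // k IH; rewrite wpowS mkFG_cat IH expgS. Qed.

Lemma winv_wpow w k : winv (wpow w k) = wpow (winv w) k.
Proof. by elim: k => // k IH; rewrite wpowS winv_cat IH -wpowSr. Qed.

Lemma reducedw_wpow w k : cycle (@redrel n) w -> reducedw (wpow w k).
Proof. exact: sorted_cycle_flatten. Qed.

Lemma reducedw_catr s t : reducedw (s ++ t) -> reducedw t.
Proof. by move/cat_sorted2 => []. Qed.

Lemma reducedw_catl s t : reducedw (s ++ t) -> reducedw s.
Proof. by move/cat_sorted2 => []. Qed.

Lemma reducedw_cat v q r :
  reducedw (rcons v q) -> reducedw (q :: r) -> reducedw (v ++ q :: r).
Proof.
rewrite -cats1 /reducedw; case: v => //= x v; rewrite !cat_path /= andbT.
by case/andP=> -> -> ->.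
Qed.

Lemma size_power_eq w m d : cycle (@redrel n) w -> reducedw m ->
  mkFG w ^+ d = mkFG m -> size m = (d * size w)%N.
Proof.
move=> cw rm; rewrite -mkFG_wpow => /fgw_inj_red E.
by rewrite -E ?size_wpow // reducedw_wpow.
Qed.

Section Split.
Variables (w s t : seq (letter n)) (q : letter n).
Hypotheses (cw : cycle (@redrel n) w) (Ew : w = s ++ q :: t).

(* The words of the two rays of the axis of w that start at the vertex reached
   after reading s; they leave it through q and back respectively. *)
Definition forward k := (q :: t) ++ wpow w k.
Definition backward k := winv s ++ wpow (winv w) k.
Definition back := lflip (last q (t ++ s)).

Lemma back_neq : back != q.
Proof. by have := cycle_turn cw Ew; rewrite /redrel /back eq_sym. Qed.

Lemma forward_reduced k : reducedw (forward k).
Proof.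
apply: (@reducedw_catr s); rewrite catA -Ew -wpowS.
exact: reducedw_wpow.
Qed.

Lemma backward_reduced k : reducedw (backward k).
Proof.
rewrite /backward -winv_wpow -winv_cat reducedw_winv.
by apply: (@reducedw_catl _ (q :: t)); rewrite -catA -Ew -wpowSr reducedw_wpow.
Qed.

Lemma backward_head k : exists r, backward k.+1 = back :: r.
Proof.
rewrite /backward /back; case/lastP: s Ew => [|r z] E.
  by rewrite cats0 wpowS E /= lastI winv_rcons; eexists.
by rewrite winv_rcons last_cat last_rcons; eexists.
Qed.

Lemma mkFG_forward k : mkFG (forward k) = (mkFG s)^-1 * mkFG w ^+ k.+1.
Proof.
apply: (mulgI (mkFG s)); rewrite mulVKg -mkFG_cat /forward catA -Ew -wpowS.
exact: mkFG_wpow.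
Qed.

Lemma mkFG_backward k : mkFG (backward k) = (mkFG s)^-1 * (mkFG w ^+ k)^-1.
Proof. by rewrite /backward mkFG_cat -winv_wpow !mkFG_winv mkFG_wpow. Qed.

Lemma backward_forward k j : mkFG (backward k) * mkFG w ^+ (k + j).+1 = mkFG (forward j).
Proof. by rewrite mkFG_backward mkFG_forward -addnS expgnDr mulgA mulgVK. Qed.

End Split.
(** If s' = s m, the equation says that the d-th power of s^-1 w s is m^-1. That conjugate is a
    rotation of [w], hence cyclically reduced, so the power has length d |w|; as |m| < |w|, both [d]
    and |m| vanish. The case of a shorter s' is similar. *)
Lemma coset_prefix w s a s' a' d :
  cycle (@redrel n) w -> w = s ++ a -> w = s' ++ a' ->
  size s < size w -> size s' < size w ->
  (mkFG s)^-1 * mkFG w ^+ d = (mkFG s')^-1 -> size s = size s' /\ d = 0%N.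
Proof.
move=> cw E E' sw s'w H.
have key b m a1 : w = b ++ a1 -> reducedw m -> size m < size w ->
    (mkFG b)^-1 * mkFG w ^+ d * mkFG b = mkFG m -> size m = 0%N /\ d = 0%N.
  move=> Eb rm mw; rewrite -mulgA -conjgE conjXg.
  have -> : mkFG w ^ mkFG b = mkFG (a1 ++ b).
    by rewrite conjgE Eb !mkFG_cat -mulgA mulKg.
  have cw' : cycle (@redrel n) (a1 ++ b) by rewrite cycle_cat_rot -Eb.
  move=> /(size_power_eq cw' rm); have -> : size (a1 ++ b) = size w.
    by rewrite Eb !size_cat addnC.
  by case: (d) => [|d'] Em; [rewrite Em|move: mw; rewrite Em mulSn ltnNge leq_addr].
have rw : reducedw w by have := reducedw_wpow 1 cw; rewrite /wpow /= cats0.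
have [ss|ss] := leqP (size s) (size s').
  have Es : s' = s ++ take (size s' - size s) a.
    have := congr1 (take (size s')) E; rewrite {1}E' take_size_cat // take_cat ltnNge ss /=.
    by [].
  set m := take _ a in Es.
  have rm : reducedw m.
    by have := rw; rewrite E' Es -catA => /reducedw_catr/reducedw_catl.
  have [|||m0 ->] := key s (winv m) a E.
  - by rewrite reducedw_winv.
  - by rewrite size_winv; move: s'w; rewrite Es size_cat; apply: leq_ltn_trans; rewrite leq_addl.
  - by rewrite H Es mkFG_cat invgM mulgVK mkFG_winv.
  by rewrite Es size_cat; rewrite size_winv in m0; rewrite m0 addn0.
have Es : s = s' ++ take (size s - size s') a'.
  have := congr1 (take (size s)) E'; rewrite {1}E take_size_cat // take_cat ltnNge (ltnW ss) /=.
  by [].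
set m := take _ a' in Es.
have rm : reducedw m.
  by have := rw; rewrite E Es -catA => /reducedw_catr/reducedw_catl.
have [|||m0 ->] := key s' m a' E'.
- by [].
- by move: sw; rewrite Es size_cat; apply: leq_ltn_trans; rewrite leq_addl.
- apply: (mulgI (mkFG m)^-1); rewrite !mulgA -invgM -(mkFG_cat s' m) -Es H mulVg.
  by rewrite mulVg.
by rewrite Es size_cat m0 addn0.
Qed.

(** An axis meets a mark at most once, namely [k] periods after its backward end; comparing [j] with
    [k] leaves a nonnegative exponent for [coset_prefix]. *)
Lemma backward_coset w s a s' a' k j :
  cycle (@redrel n) w -> w = s ++ a -> w = s' ++ a' ->
  size s < size w -> size s' < size w ->
  mkFG (backward w s k) * mkFG w ^+ j = (mkFG s')^-1 -> size s = size s' /\ j = k.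
Proof.
move=> cw E E' sw s'w; rewrite mkFG_backward => H.
have [kj|jk] := leqP k j.
  have [|-> d0] := coset_prefix (d := j - k) cw E E' sw s'w.
    by rewrite -H -{2}(subnKC kj) expgnDr !mulgA mulgVK.
  by split=> //; apply/eqP; rewrite eqn_leq kj -subn_eq0 d0.
have [|-> d0] := coset_prefix (d := k - j) cw E' E s'w sw; last first.
  by move: d0 => /eqP; rewrite subn_eq0 leqNgt jk.
rewrite -H -!mulgA -expgnDr subnKC ?(ltnW jk) // mulVg mulg1 //.
Qed.

End Powers.

(** * Eventual values on cones of the tree, and repeated letters *)

Section Tree.
Local Open Scope group_scope.
Variable n : nat.
Implicit Types (l x y p q c : letter n) (s t v : seq (letter n)) (g h u : FG n).

(** Only finitely many edges of the Cayley tree carry a change of [phi]; beyond the longest of their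
    starting points no reduced path meets one. *)
Lemma far_constant phi : @almost_invariant n phi ->
  exists N, forall v t, N <= size v -> reducedw (v ++ t) -> phi (mkFG (v ++ t)) = phi (mkFG v).
Proof.
move=> aphi.
have [F HF] : exists F : letter n -> seq (FG n),
    forall l g, g \notin F l -> phi (g * mkFG [:: l]) = phi g.
  have H l : exists s : seq (FG n), forall g, g \notin s -> phi (g * mkFG [:: l]) = phi g.
    exact: aphi.
  by have [F HF] := fin_all_exists H; exists F.
pose L := flatten [seq F l | l <- enum (@predT (letter n))].
exists (\max_(g <- L) size (fgw g)).+1 => v t vN.
elim/last_ind: t => [|t l IH]; first by rewrite cats0.
rewrite -rcons_cat => rv; have rvt : reducedw (v ++ t).
  by move: rv; rewrite -cats1 => /reducedw_catl.
rewrite -IH // -cats1 mkFG_cat HF //; apply/negP => inF.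
have : mkFG (v ++ t) \in L.
  by apply/flattenP; exists (F l) => //; apply: map_f; rewrite mem_enum.
move=> inL; have := @leq_bigmax_seq _ L predT (fun g => size (fgw g)) _ inL isT.
by rewrite fgwK // size_cat leqNgt (leq_trans vN (leq_addr _ _)).
Qed.

Lemma sum_along phi (f : FG n -> int) u g m :
  (forall h, (phi (h * u)%g - phi h = f h)%R) ->
  (phi (g * u ^+ m)%g - phi g = \sum_(j < m) f (g * u ^+ j)%g)%R.
Proof.
move=> H; elim: m => [|m IH]; first by rewrite big_ord0 mulg1 subrr.
by rewrite big_ord_recr /= -IH -H expgSr mulgA addrC addrA subrK.
Qed.

Section TwoOccurrences.
Variable w : seq (letter n).
Hypotheses (cw : cycle (@redrel n) w) (ncw : no_cut_vertex w).
Variables (phi : FG n -> int) (x : letter n).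
Variables (s1 t1 s2 t2 : seq (letter n)).
Hypotheses (E1 : w = s1 ++ x :: t1) (E2 : w = s2 ++ x :: t2) (s12 : size s1 < size s2).
Local Notation u := (mkFG w).
Let h1 := (mkFG s1)^-1.
Let h2 := (mkFG s2)^-1.
Hypothesis Hphi :
  forall h, (phi (h * u)%g - phi h = (h == h1)%:R - (h == h2)%:R)%R.
Variable N : nat.
Hypothesis HN : forall v t, N <= size v -> reducedw (v ++ t) ->
  phi (mkFG (v ++ t)) = phi (mkFG v).

(* Forwards, the marked axes end in the cone of words beginning with x, and
   backwards they end outside it; the condition on heads excludes this for the
   axis through v. *)
Lemma line_not_marked s q t v k j s' t' :
  w = s ++ q :: t -> w = s' ++ x :: t' ->
  reducedw (rcons v q) -> reducedw (rcons v (back s t q)) ->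
  (head q v != x) || (head (back s t q) v == x) ->
  mkFG (v ++ backward w s k) * u ^+ j != (mkFG s')^-1.
Proof.
move=> E E' rq rp hd; apply/eqP => H.
set g := mkFG (v ++ backward w s k) in H.
have F i : mkFG (v ++ forward w t q i) = g * u ^+ (k + i).+1.
  by rewrite /g !(mkFG_cat v) -mulgA (backward_forward E).
have B i : mkFG (v ++ backward w s (k + i)) = g * (u ^+ i)^-1.
  by rewrite /g !(mkFG_cat v) !mkFG_backward -!mulgA addnC expgnDr invgM.
have rF i : reducedw (v ++ forward w t q i) by apply: reducedw_cat => //; apply: (forward_reduced cw E).
have rB i : reducedw (v ++ backward w s i.+1).
  have := backward_reduced cw E i.+1; have [r ->] := backward_head E i.
  by apply: reducedw_cat.
have F' : forward w t' x k = v ++ forward w t q j.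
  apply: fgw_inj_red => //; first exact: (forward_reduced cw E').
  by rewrite (mkFG_forward E') F -H -mulgA -expgnDr addnS addnC.
have B' : backward w s' j.+1 = v ++ backward w s k.+1.
  apply: fgw_inj_red => //; first exact: (backward_reduced cw E').
  by rewrite mkFG_backward -H -(addn1 k) B expg1 expgS invgM mulgA mulgK.
have hF : x = head q v by have := congr1 (head q) F'; rewrite /= ; case: (v).
have hB : back s' t' x = head (back s t q) v.
  have [r Er] := backward_head E' j; have [r' Er'] := backward_head E k.
  by have := congr1 (head (back s t q)) B'; rewrite Er Er' /=; case: (v).
by move: hd; rewrite -hF -hB eqxx (negbTE (back_neq cw E')).
Qed.

(** The two ends differ by the sum of the marks met along the line, and [line_not_marked] excludes
    both marks. *)
Lemma line_const s q t v k :
  w = s ++ q :: t ->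
  reducedw (rcons v q) -> reducedw (rcons v (back s t q)) ->
  (head q v != x) || (head (back s t q) v == x) ->
  phi (mkFG (v ++ forward w t q k)) = phi (mkFG (v ++ backward w s k)).
Proof.
move=> E rq rp hd; apply/eqP; rewrite -subr_eq0.
have -> : mkFG (v ++ forward w t q k) = mkFG (v ++ backward w s k) * u ^+ (k + k).+1.
  by rewrite !(mkFG_cat v) -mulgA (backward_forward E).
rewrite (sum_along _ _ Hphi) big1 // => j _.
have /negbTE -> := line_not_marked k j E E1 rq rp hd.
by have /negbTE -> := line_not_marked k j E E2 rq rp hd.
Qed.

(** By hypothesis [phi] has one eventual value on each cone leaving [v] in a direction other than
    [c]. A Whitehead edge avoiding [c] gives a line through [v] between two of these cones, and
    [line_const] equates their values. Since the graph stays connected without [c], all values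
    agree. *)
Lemma branch_constant v c :
  (forall l, l != c -> reducedw (rcons v l)) ->
  (forall l t t', l != c -> reducedw (rcons v l ++ t) -> reducedw (rcons v l ++ t') ->
     N <= size (rcons v l ++ t) -> N <= size (rcons v l ++ t') ->
     phi (mkFG (rcons v l ++ t)) = phi (mkFG (rcons v l ++ t'))) ->
  (forall p q, p != c -> q != c -> (head q v != x) || (head p v == x)) ->
  forall l l' r r', l != c -> l' != c -> reducedw (v ++ l :: r) -> reducedw (v ++ l' :: r') ->
    N <= size (v ++ l :: r) -> N <= size (v ++ l' :: r') ->
    phi (mkFG (v ++ l :: r)) = phi (mkFG (v ++ l' :: r')).
Proof.
move=> rv Cv hd l0.
have w0 : 0 < size w by rewrite E1 size_cat /= addnS.
have rns l : l != c -> reducedw (v ++ nseq N.+1 l).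
  move=> lc; apply: reducedw_cat; first exact: rv.
  by rewrite -/(nseq N.+1 l); elim: N => //= k ->; rewrite /redrel eq_sym lflip_neq.
(* The point v l^(N+1) represents the cone in direction [l]; a repeated letter never cancels. *)
pose b l := phi (mkFG (v ++ nseq N.+1 l)).
have Eb l r : l != c -> reducedw (v ++ l :: r) -> N <= size (v ++ l :: r) ->
    phi (mkFG (v ++ l :: r)) = b l.
  move=> lc; have := rns l lc; rewrite /b /= -!cat_rcons => R1 R2 S2.
  by apply: Cv => //; rewrite size_cat size_nseq leq_addl.
suff bc l : l0 != c -> l != c -> b l0 = b l.
  by move=> l' r r' lc lc' r1 r2 sz1 sz2; rewrite !Eb // -!bc.
move=> l0c lc; pose Y := [set l | (l != c) && (b l == b l0)].
move/forallP/(_ c)/forallP/(_ Y)/implyP: ncw; rewrite inE eqxx => /(_ isT)/implyP.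
case/(_ _)/orP => [|/eqP/setP/(_ l0)|/eqP/setP/(_ l)].
- apply: cycle_split => s q t E; rewrite -/(back s t q).
  have [//|pc] := eqVneq (back s t q) c; have [//|qc] := eqVneq q c.
  rewrite /= !inE pc qc /=; suff -> : b (back s t q) = b q by [].
  have rq := rv _ qc; have rp := rv _ pc.
  have := line_const N.+1 E rq rp (hd _ _ pc qc).
  have rF := forward_reduced cw E N.+1; have rB := backward_reduced cw E N.+1.
  have NL : N <= (N.+1 * size w)%N by rewrite (leq_trans (leqnSn N)) // leq_pmulr.
  have sF : N <= size (forward w t q N.+1).
    by rewrite size_cat size_wpow; apply: (leq_trans NL); apply: leq_addl.
  have sB : N <= size (backward w s N.+1).
    by rewrite size_cat size_wpow !size_winv; apply: (leq_trans NL); apply: leq_addl.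
  have [r Er] := backward_head E N; rewrite Er in rB sB *.
  have -> : phi (mkFG (v ++ forward w t q N.+1)) = b q.
    apply: Eb => //; first exact: (reducedw_cat rq rF).
    by rewrite size_cat; apply: leq_trans (leq_addl _ _).
  have -> // : phi (mkFG (v ++ back s t q :: r)) = b (back s t q).
  apply: Eb => //; first exact: (reducedw_cat rp rB).
  by rewrite size_cat; apply: leq_trans (leq_addl _ _).
- by rewrite !inE l0c eqxx.
- by rewrite !inE lc /= => /eqP.
Qed.

(** Induction from distance [N] inwards; at [v] the excluded direction is the one back to 1, inverse
    to the last letter. Both heads are the first letter of [v], so the last condition of
    [branch_constant] is automatic. *)
Lemma cone_constant v t t' : v != [::] -> reducedw (v ++ t) -> reducedw (v ++ t') ->
  N <= size (v ++ t) -> N <= size (v ++ t') -> phi (mkFG (v ++ t)) = phi (mkFG (v ++ t')).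
Proof.
have [d] := ubnP (N - size v); elim: d => // d IH in v t t' *.
move=> dN v0 r1 r2 sz1 sz2.
have [Nv|vN] := leqP N (size v); first by rewrite !HN.
case: t r1 sz1 => [|l r] r1 sz1; first by move: sz1; rewrite cats0 leqNgt vN.
case: t' r2 sz2 => [|l' r'] r2 sz2; first by move: sz2; rewrite cats0 leqNgt vN.
case/lastP: v v0 vN dN r1 r2 sz1 sz2 => // v z _ vN dN r1 r2 sz1 sz2.
have rvz : reducedw (rcons v z) by apply: reducedw_catl r1.
have lc k t : reducedw (rcons v z ++ k :: t) -> k != lflip z.
  rewrite -cat_rcons => /reducedw_catl; rewrite reducedw_rcons => /andP[_].
  by rewrite -eq_lflip eq_sym.
apply: (@branch_constant _ (lflip z)); rewrite ?(lc _ _ r1) ?(lc _ _ r2) //.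
- by move=> k kz; rewrite reducedw_rcons rvz -eq_lflip eq_sym.
- move=> k t t' kz R1 R2 S1 S2; apply: IH => //; last by case: (v).
  by rewrite size_rcons; rewrite -ltnS; apply: leq_trans dN; rewrite ltnS; lia.
by move=> p q _ _; case: (v) => [|y v'] /=; case: eqP.
Qed.

(** At the vertex 1, excluding the direction [x] discards the lines through the edge from 1 to [x],
    among them the marked ones. *)
Lemma outside_constant l l' r r' : l != x -> l' != x ->
  reducedw (l :: r) -> reducedw (l' :: r') -> N <= size (l :: r) -> N <= size (l' :: r') ->
  phi (mkFG (l :: r)) = phi (mkFG (l' :: r')).
Proof.
apply: (@branch_constant [::] x) => //= [l0 t t' _ R1 R2 S1 S2|p q _ ->] //.
exact: (@cone_constant [:: l0] t t').
Qed.

(** Both marked lines run from outside the cone of [x] into it, so constancy on either side makes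
    their jumps equal; but these are +1 and -1. *)
Lemma two_occurrences : False.
Proof.
have w0 : 0 < size w by rewrite E1 size_cat /= addnS.
have sw1 : size s1 < size w by rewrite E1 size_cat /= addnS ltnS leq_addr.
have sw2 : size s2 < size w by rewrite E2 size_cat /= addnS ltnS leq_addr.
pose k := N.+1.
have NL : N <= (k * size w)%N by rewrite (leq_trans (leqnSn N)) // leq_pmulr.
have jump s t (E : w = s ++ x :: t) : (phi (mkFG (forward w t x k)) - phi (mkFG (backward w s k)) =
    (size s == size s1)%:R - (size s == size s2)%:R)%R.
  have sw : size s < size w by rewrite E size_cat /= addnS ltnS leq_addr.
  rewrite -(backward_forward E k k) (sum_along _ _ Hphi) GRing.sumrB.
  have S s' t' (E' : w = s' ++ x :: t') :
    (\sum_(j < (k + k).+1) (mkFG (backward w s k) * u ^+ j == (mkFG s')^-1)%g%:R =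
     (size s == size s')%:R :> int)%R.
    have sw' : size s' < size w by rewrite E' size_cat /= addnS ltnS leq_addr.
    have [ss|ss] := eqVneq (size s) (size s'); last first.
      rewrite big1 // => j _; case: eqP => // /(backward_coset cw E E' sw sw')[] e.
      by rewrite e eqxx in ss.
    have kk : k < (k + k).+1 by rewrite ltnS leq_addr.
    rewrite (bigD1 (Ordinal kk)) //= big1 ?addr0; last first.
      move=> j jk; case: eqP => // /(backward_coset cw E E' sw sw')[_ e].
      by case/eqP: jk; apply: val_inj.
    have -> : s' = s.
      have := congr1 (take (size s)) E; rewrite {1}E' ss take_size_cat // => ->.
      by rewrite -ss take_size_cat.
    by rewrite mkFG_backward mulgVK eqxx.
  by rewrite (S _ _ E1) (S _ _ E2).
have J1 := jump _ _ E1; have J2 := jump _ _ E2.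
have F : phi (mkFG (forward w t1 x k)) = phi (mkFG (forward w t2 x k)).
  have sF t : N <= size (forward w t x k).
    by rewrite size_cat size_wpow; apply: (leq_trans NL); apply: leq_addl.
  exact: (@cone_constant [:: x] (t1 ++ wpow w k) (t2 ++ wpow w k) isT
    (forward_reduced cw E1 k) (forward_reduced cw E2 k) (sF t1) (sF t2)).
have B : phi (mkFG (backward w s1 k)) = phi (mkFG (backward w s2 k)).
  have sB s : N <= size (backward w s k).
    by rewrite size_cat size_wpow !size_winv; apply: (leq_trans NL); apply: leq_addl.
  have := sB s1; have := sB s2.
  have := backward_reduced cw E1 k; have := backward_reduced cw E2 k.
  have [r1 ->] := backward_head E1 N; have [r2 ->] := backward_head E2 N => *.
  by apply: outside_constant => //; [exact: (back_neq cw E1)|exact: (back_neq cw E2)].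
move: J1; rewrite F B J2 !eqxx (ltn_eqF s12) (gtn_eqF s12).
by [].
Qed.

End TwoOccurrences.

Lemma count_letter w x : cycle (@redrel n) w -> no_cut_vertex w ->
  coboundary_onto (mkFG w) -> count_mem x w <= 1.
Proof.
move=> cw ncw [uP _]; rewrite leqNgt; apply/negP => x2.
have [s1 [t1 [s2 [t2 [E1 E2 s12]]]]] : exists s1 t1 s2 t2,
    [/\ w = s1 ++ x :: t1, w = s2 ++ x :: t2 & size s1 < size s2].
  have xw : x \in w by rewrite -has_pred1 has_count; apply: ltn_trans x2.
  case: (splitPr xw) x2 => s t; rewrite count_cat /= eqxx add1n addnS ltnS addn_gt0.
  rewrite -!has_count !has_pred1 => /orP[/splitPr xs|/splitPr xt].
    case: xs => a b; exists a, (b ++ x :: t), (a ++ x :: b), t.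
    by rewrite -catA; split=> //; rewrite size_cat /= addnS ltnS leq_addr.
  case: xt => a b; exists s, (a ++ x :: b), (s ++ x :: a), b.
  by rewrite -catA; split=> //; rewrite size_cat /= addnS ltnS leq_addr.
(* Translating the axis by these inverses places both occurrences of [x] on the edge from 1 to
   [x]. *)
have [phi aphi Hphi] := uP (mkFG s1)^-1 (mkFG s2)^-1.
have [N HN] := far_constant aphi.
exact: (two_occurrences cw ncw E1 E2 s12 Hphi HN).
Qed.

(** If [x] did not occur, its vertex would have at most one edge, given by the single x^-1. Removing
    its neighbour isolates [x], and with at least 4 vertices something else remains, so the
    neighbour would be a cut vertex. *)
Lemma mem_no_cut w x : 2 <= n -> cycle (@redrel n) w -> no_cut_vertex w ->
  count_mem (lflip x) w <= 1 -> x \in w.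
Proof.
move=> n2 cw ncw c1; apply: contraT => xw.
suff [c cx wc] : exists2 c, c != x & wclosed c [set x] w.
  move/forallP/(_ c)/forallP/(_ [set x])/implyP: ncw; rewrite inE => /(_ cx)/implyP/(_ wc).
  case/orP=> /eqP/(congr1 (fun A : {set letter n} => #|A|)).
    by rewrite cards1 cards0.
  rewrite cards1 cardsC1 card_prod card_ord card_bool.
  by case: (n) n2 => [|[|k]] // _; rewrite mulSn.
have [xVw|xVw] := boolP (lflip x \in w); last first.
  (* Here [x] is an isolated vertex, and any other vertex can be removed. *)
  exists (lflip x); first by rewrite lflip_neq.
  apply: cycle_split => s y t E; rewrite !inE.
  have -> : (y == x) = false by apply: contraNF xw => /eqP <-; rewrite E mem_cat inE eqxx orbT.
  have -> : (lflip (last y (t ++ s)) == x) = false; last by rewrite !orbT.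
  rewrite eq_lflip; apply: contraNF xVw => /eqP <-.
  by rewrite E -(mem_rot (size s)) rot_size_cat /= mem_last.
case/splitPr: xVw cw ncw c1 xw => s t; rewrite /wclosed cycle_cat_rot /= => cw _.
rewrite count_cat /= eqxx add1n addnS ltnS leqn0 addn_eq0 => /andP[cs ct].
rewrite mem_cat inE !negb_or => /and3P[xs xxV xt].
have xVr : lflip x \notin t ++ s.
  by rewrite mem_cat negb_or -!has_pred1 !has_count -!eqn0Ngt cs ct.
have xr : x \notin t ++ s by rewrite mem_cat negb_or xs xt.
(* The neighbour of [x] is the letter cyclically following x^-1; the default covers the word
   consisting of x^-1 alone. *)
exists (head (lflip x) (t ++ s)).
  move: cw; case: (t ++ s) => [|y r] /=; first by rewrite lflip_neq.
  by case/andP; rewrite /redrel lflipK.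
rewrite cycle_cat_rot /=; case: (t ++ s) xr xVr => [|y r] /= xr xVr; first by rewrite eqxx orbT.
rewrite eqxx orbT /=; apply: path_split => a z b E.
have zx : (z == x) = false.
  apply/eqP => zx; have : z \in rcons r (lflip x) by rewrite E mem_cat inE eqxx orbT.
  rewrite zx mem_rcons inE (negbTE xxV) /= => xr'.
  by rewrite inE xr' orbT in xr.
rewrite !inE zx (eq_lflip _ x).
have -> : (last y a == lflip x) = false; last by rewrite !orbT.
apply/eqP => El; have : lflip x \in y :: r; last by rewrite (negbTE xVr).
rewrite -El; have := mem_last y a; rewrite !inE => /orP[->//|la].
apply/orP; right; have : last y a \in rcons r (lflip x).
  by rewrite E mem_cat la.
move: E; case/lastP: b => [|b z']; rewrite ?cats1 -?rcons_cons -?rcons_cat => /rcons_inj[-> _] _ //.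
by rewrite mem_cat la.
Qed.

End Tree.

(** * Normalisation of handles *)

Section Classification.
Local Open Scope group_scope.
Variable n : nat.
Implicit Types (l x y : letter n) (s t w : seq (letter n)) (u v : FG n).
Implicit Types (ps : seq (letter n * letter n)).
Local Notation "u ~ v" := (aut_eq u v) (at level 70).

Definition letter_comm x y : seq (letter n) := [:: x; y; lflip x; lflip y].
Definition comm_word ps := flatten [seq letter_comm p.1 p.2 | p <- ps].

Lemma comm_word_rcons ps x y : comm_word (rcons ps (x, y)) = comm_word ps ++ letter_comm x y.
Proof. by rewrite /comm_word map_rcons flatten_rcons. Qed.

Lemma comm_word_flip ps l : l \in comm_word ps -> lflip l \in comm_word ps.
Proof.
case/flattenP=> s /mapP[p pps ->] lp; apply/flattenP; exists (letter_comm p.1 p.2).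
  by apply/mapP; exists p.
by move: lp; rewrite !inE => /or4P[] /eqP ->; rewrite ?lflipK eqxx ?orbT.
Qed.

Definition linked s := exists R0 x A y B C R1,
  s = R0 ++ x :: A ++ y :: B ++ lflip x :: C ++ lflip y :: R1.

(** Look at the first letter [y] of the segment [S] between [l] and its inverse. Its inverse lies
    outside, and the pairs are linked, or inside [S], which gives a shorter segment; an empty [S] is
    a cancelling pair. *)
Lemma linked_or_cancel s : uniq s -> {in s, forall l, lflip l \in s} -> s != [::] ->
  (exists s1 l s2, s = s1 ++ l :: lflip l :: s2) \/ linked s.
Proof.
move=> us sV s0.
have [R0 [l [S [R1 E]]]] : exists R0 l S R1, s = R0 ++ l :: S ++ lflip l :: R1.
  case: s s0 us sV => // l t _ _ /(_ l); rewrite inE eqxx => /(_ isT).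
  rewrite inE lflip_neq /= => /splitPr[S R1].
  by exists [::], l, S, R1.
have [k] := ubnP (size S); elim: k => // k IH in R0 l S R1 E *.
case: S E => [|y S] E Sk; first by left; exists R0, l, R1.
have yS : lflip y \in s by apply: sV; rewrite E !(mem_cat, inE) eqxx !orbT.
have cnt := count_uniq_mem _ us.
have lf : (lflip y == l) = false.
  apply/negP => /eqP e; have := cnt y; rewrite {1}E -e lflipK.
  by rewrite !(count_cat, count_cons) /= eqxx; case: (_ \in _) => /=; lia.
have ll : (lflip y == lflip l) = false.
  apply/negP => /eqP/lflip_inj e; have := cnt l; rewrite {1}E e.
  by rewrite !(count_cat, count_cons) /= eqxx; case: (_ \in _) => /=; lia.
move: yS; rewrite {1}E !(mem_cat, inE) lf ll lflip_neq /=.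
case/or3P=> [/splitPr yR|/splitPr yS|/splitPr yR].
- case: yR E => a b E; right; exists a, (lflip y), b, l, [::], S, R1.
  by rewrite E lflipK -catA.
- case: yS E Sk => a b E Sk.
  apply: (IH (R0 ++ [:: l]) y a (b ++ lflip l :: R1)).
    by rewrite E -!catA /= -catA.
  by move: Sk; rewrite /= size_cat /= ltnS; apply: leq_ltn_trans; apply: leq_addr.
- case: yR E => a b E; right; exists R0, l, [::], y, S, a, b.
  by rewrite E.
Qed.

Section Handle.
Variables (x y : letter n) (PX QX PY QY : seq (letter n)).
Let T := [pred i | (i == x.1) || (i == y.1)].
Hypothesis xy : x.1 != y.1.
Hypotheses (aPX : avoids T PX) (aQX : avoids T QX) (aPY : avoids T PY) (aQY : avoids T QY).

(** [transv] prescribes images of generators, whereas [x] and [y] may be inverse letters; inverting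
    the image of such a letter inverts its two side words and swaps them. *)
Let P i := if i == x.1 then if x.2 then winv QX else PX
           else if i == y.1 then if y.2 then winv QY else PY else [::].
Let Q i := if i == x.1 then if x.2 then winv PX else QX
           else if i == y.1 then if y.2 then winv PY else QY else [::].

Lemma two_letter_aut : exists2 f : 'I_n -> FG n, fg_aut (fhom f) &
  [/\ fhom f (mkFG [:: x]) = mkFG (PX ++ x :: QX),
      fhom f (mkFG [:: y]) = mkFG (PY ++ y :: QY) &
      forall s, avoids T s -> fhom f (mkFG s) = mkFG s].
Proof.
have off i : ~~ T i -> P i = [::] /\ Q i = [::].
  by rewrite /P /Q negb_or => /andP[/negbTE -> /negbTE ->].
have av i : avoids T (P i) /\ avoids T (Q i).
  by rewrite /P /Q; split; do !case: ifP => _; rewrite ?avoids_winv.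
have yx : (y.1 == x.1) = false by rewrite eq_sym (negbTE xy).
have letter_inv l (R S : seq (letter n)) : l.2 ->
    (mkFG (winv S ++ (l.1, false) :: winv R))^-1 = mkFG (R ++ l :: S).
  case: l => i [] // _; rewrite -mkFG_winv winv_cat winv_cons !winvK cat_rcons.
  by [].
exists (transv P Q); first exact: transv_aut av off.
split; last exact: fhom_transv_avoid off.
- rewrite fhom_letter /ev /transv /P /Q eqxx; case: ifP => [x2|x2]; rewrite x2; first exact: letter_inv.
  by rewrite -x2 -surjective_pairing.
- rewrite fhom_letter /ev /transv /P /Q yx eqxx; case: ifP => [y2|y2]; rewrite y2; first exact: letter_inv.
  by rewrite -y2 -surjective_pairing.
Qed.
End Handle.

(* With X = R0 x (R0 C B)^-1 and Y = R0 C B A y (R0 C)^-1, the identity is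
   R0 x A y B x^-1 C y^-1 R1 = X Y X^-1 Y^-1 R0 C B A R1. *)
Lemma handle_step K R0 x A y B C R1 :
  uniq (K ++ R0 ++ x :: A ++ y :: B ++ lflip x :: C ++ lflip y :: R1) ->
  mkFG (K ++ R0 ++ x :: A ++ y :: B ++ lflip x :: C ++ lflip y :: R1) ~
  mkFG (K ++ letter_comm x y ++ R0 ++ C ++ B ++ A ++ R1).
Proof.
set W := K ++ _ => uW.
have pW : perm_eq W (letter_comm x y ++ K ++ R0 ++ A ++ B ++ C ++ R1).
  by apply/permP => a; rewrite /W !(count_cat, count_cons) /=; lia.
move: uW; rewrite (perm_uniq pW) cat_uniq => /and3P[u4 nh _].
pose T := [pred i | (i == x.1) || (i == y.1)].
have xy : x.1 != y.1.
  by rewrite letter_eq1; apply/negP => /orP[]/eqP E; move: u4; rewrite E /= !inE ?lflipK eqxx ?orbT ?andbF.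
have av s : {subset s <= K ++ R0 ++ A ++ B ++ C ++ R1} -> avoids T s.
  move=> sub; apply/allP => l ls; apply: contra nh => /= Tl; apply/hasP; exists l.
    exact: sub.
  move: Tl; rewrite !letter_eq1 !inE => /orP[]/orP[]/eqP ->; by rewrite eqxx ?orbT.
have aR0 : avoids T R0 by apply: av => l; rewrite !mem_cat => ->; rewrite ?orbT.
have aA : avoids T A by apply: av => l; rewrite !mem_cat => ->; rewrite ?orbT.
have aB : avoids T B by apply: av => l; rewrite !mem_cat => ->; rewrite ?orbT.
have aC : avoids T C by apply: av => l; rewrite !mem_cat => ->; rewrite ?orbT.
have aR1 : avoids T R1 by apply: av => l; rewrite !mem_cat => ->; rewrite ?orbT.
have aK : avoids T K by apply: av => l; rewrite !mem_cat => ->; rewrite ?orbT.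
have avc s t : avoids T s -> avoids T t -> avoids T (s ++ t).
  by rewrite /avoids all_cat => -> ->.
have [f fA [fx fy fs]] := @two_letter_aut x y R0 (winv (R0 ++ C ++ B))
  (R0 ++ C ++ B ++ A) (winv (R0 ++ C)) xy aR0
  (etrans (avoids_winv _ _) (avc _ _ aR0 (avc _ _ aC aB)))
  (avc _ _ aR0 (avc _ _ aC (avc _ _ aB aA)))
  (etrans (avoids_winv _ _) (avc _ _ aR0 aC)).
(* The automorphism maps [x] to X and [y] to Y, so it carries the word with the commutator to
   [W]. *)
apply: aut_sym; exists (fhom f) => //.
rewrite (mkFG_cat K) fhomM (fs K aK) /W (mkFG_cat K); congr (_ * _).
rewrite (mkFG_cat (letter_comm x y)) fhomM (fs (R0 ++ C ++ B ++ A ++ R1)); last first.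
  exact: (avc _ _ aR0 (avc _ _ aC (avc _ _ aB (avc _ _ aA aR1)))).
rewrite /letter_comm (mkFG_cons x) (mkFG_cons y) (mkFG_cons (lflip x)) !fhomM !mkFG_flip !fhomV.
rewrite fx fy -(cat1s x (winv _)) -(cat1s y (winv _)) -(cat1s x (A ++ _)).
rewrite -(cat1s y (B ++ _)) -(cat1s (lflip x) (C ++ _)) -(cat1s (lflip y) R1).
rewrite !mkFG_cat !mkFG_winv !mkFG_cat !mkFG_flip !invgM !invgK !mulgA.
by rewrite !mulgVK.
Qed.

End Classification.

Section NormalForm.
Local Open Scope group_scope.
Variable n : nat.
Implicit Types (l x y : letter n) (s t w : seq (letter n)) (u v : FG n).
Implicit Types (ps : seq (letter n * letter n)).
Local Notation "u ~ v" := (aut_eq u v) (at level 70).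

(** Each linked pair in [s] is moved into the commutator prefix, which shortens [s] and only
    permutes the letters of the whole word. *)
Lemma commutator_normal_form ps s :
  uniq (comm_word ps ++ s) -> (forall l, l \in comm_word ps ++ s) ->
  coboundary_onto (mkFG (comm_word ps ++ s)) ->
  exists ps', [/\ mkFG (comm_word ps ++ s) ~ mkFG (comm_word ps'), uniq (comm_word ps') &
                  forall l, l \in comm_word ps'].
Proof.
have [k] := ubnP (size s); elim: k => // k IH in ps s *; move=> sk us als onto.
have [s0|s0] := eqVneq s [::].
  by rewrite s0 cats0 in us als *; exists ps; split=> //; apply: aut_refl.
have sV : {in s, forall l, lflip l \in s}.
  move=> l ls; have := als (lflip l); rewrite mem_cat => /orP[/comm_word_flip|//].
  rewrite lflipK => lp; move: us; rewrite cat_uniq => /and3P[_ /hasP[]].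
  by exists l.
have us' : uniq s by move: us; rewrite cat_uniq => /and3P[].
case: (linked_or_cancel us' sV s0) => [[s1 [l [s2 E]]]|[R0 [x [A [y [B [C [R1 E]]]]]]]].
  (* Cancelling the adjacent pair would leave a word without this generator, as each letter occurs
     only once; [occurs_letter] forbids it. *)
  have eqG : mkFG (comm_word ps ++ s) = mkFG (comm_word ps ++ s1 ++ s2).
    by rewrite E !catA mkFG_cancel.
  have := occurs_letter l (eq_ind _ (@coboundary_onto n) onto _ eqG).
  have := count_uniq_mem l us; have := count_uniq_mem (lflip l) us.
  rewrite !als E -!has_pred1 !has_count !(count_cat, count_cons) /=.
  by rewrite !eqxx lflip_neq eq_sym lflip_neq; lia.
have pW : perm_eq (comm_word ps ++ s) (comm_word (rcons ps (x, y)) ++ R0 ++ C ++ B ++ A ++ R1).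
  by apply/permP => a; rewrite comm_word_rcons E !(count_cat, count_cons) /=; lia.
have step : mkFG (comm_word ps ++ s) ~ mkFG (comm_word (rcons ps (x, y)) ++ R0 ++ C ++ B ++ A ++ R1).
  rewrite comm_word_rcons -catA E; by apply: handle_step; rewrite -E.
have [|||| ps' [e u' a']] := IH (rcons ps (x, y)) (R0 ++ C ++ B ++ A ++ R1).
- by move: sk; rewrite E; do 4!rewrite !size_cat /=; lia.
- by rewrite -(perm_uniq pW).
- by move=> l; rewrite -(perm_mem pW).
- exact: coboundary_onto_aut step onto.
by exists ps'; split=> //; apply: aut_trans step e.
Qed.

Lemma size_comm_word ps : size (comm_word ps) = (4 * size ps)%N.
Proof. by elim: ps => //= p ps IH; rewrite /comm_word /= in IH *; rewrite IH mulnS. Qed.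

Lemma mkFG_comm_word ps :
  mkFG (comm_word ps) = \prod_(p <- ps) mkFG (letter_comm p.1 p.2).
Proof.
elim: ps => [|p ps IH]; first by rewrite big_nil.
by rewrite big_cons -IH -mkFG_cat.
Qed.

(** A surjection of the finite index set onto itself is a bijection, and the inverse map carries the
    same signs. *)
Lemma signed_perm_aut (f : 'I_n -> letter n) :
  (forall j, exists i, (f i).1 = j) -> fg_aut (fhom (fun i => mkFG [:: f i])).
Proof.
move=> /fin_all_exists[g gK].
have fK : cancel (fun i => (f i).1) g by apply: canF_sym.
apply: (@fg_aut_fhom _ _ (fun j => mkFG [:: (g j, (f (g j)).2)])) => i.
  rewrite fhom_letter /ev /=; have := gK i; case: (f (g i)) => j [] /= ->.
    by rewrite -mkFG_flip.
  by [].
rewrite fhom_letter /ev /= (fK i); by case: (f i) => j [].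
Qed.

End NormalForm.

(** * Matching commutator words with the surface word *)

Section Surface.
Local Open Scope group_scope.

Lemma fg_commE n (g h : FG n) : fg_comm g h = g^-1 * h^-1 * g * h.
Proof. by []. Qed.

Lemma fg_comm_letters n (x y : letter n) :
  fg_comm (mkFG [:: lflip x]) (mkFG [:: lflip y]) = mkFG (letter_comm x y).
Proof.
rewrite /letter_comm (mkFG_cons x) (mkFG_cons y) (mkFG_cons (lflip x) [:: _]) !mulgA.
by rewrite [LHS]fg_commE -!mkFG_flip !lflipK.
Qed.

Lemma u_surface_comm_word m (ps : seq (letter (2 * m) * letter (2 * m))) :
  size ps = m -> (forall l, l \in comm_word ps) -> aut_eq (u_surface m) (mkFG (comm_word ps)).
Proof.
case: m => [|m] in ps *.
  case: ps => // _ _; rewrite /u_surface big_ord0; exact: aut_refl.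
move=> sz al; have x0 : letter (2 * m.+1) by exact: (Ordinal (ord_even_lt (@ord0 m)), false).
pose pr k := nth (x0, x0) ps k.
(* [fg_comm] is a^-1 b^-1 a b while [letter_comm] reads x y x^-1 y^-1, so generators go to the
   inverses of the paired letters. *)
pose f (i : 'I_(2 * m.+1)) := if odd i then lflip (pr i./2).2 else lflip (pr i./2).1.
have fe (k : 'I_m.+1) : f (Ordinal (ord_even_lt k)) = lflip (pr k).1.
  by rewrite /f /= oddM /= (_ : (2 * k)./2 = k) // mul2n doubleK.
have fo (k : 'I_m.+1) : f (Ordinal (ord_odd_lt k)) = lflip (pr k).2.
  by rewrite /f /= oddM /= (_ : uphalf (2 * k) = k) // mul2n uphalf_double.
exists (fhom (fun i => mkFG [:: f i])).
  apply: signed_perm_aut => j; have /flattenP[s /mapP[p pps ->]] := al (j, false).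
  have ip : index p ps < m.+1 by move: pps; rewrite -index_mem sz.
  have prp : pr (Ordinal ip) = p by rewrite /pr nth_index.
  rewrite !inE => /or4P[] /eqP e.
  - by exists (Ordinal (ord_even_lt (Ordinal ip))); rewrite fe prp -e.
  - by exists (Ordinal (ord_odd_lt (Ordinal ip))); rewrite fo prp -e.
  - by exists (Ordinal (ord_even_lt (Ordinal ip))); rewrite fe prp -e.
  - by exists (Ordinal (ord_odd_lt (Ordinal ip))); rewrite fo prp -e.
rewrite mkFG_comm_word (big_nth (x0, x0)) sz big_mkord.
rewrite /u_surface (big_morph (fhom _) (fhomM _) (fhom1 _)).
apply: eq_bigr => k _; rewrite -fg_comm_letters.
by rewrite !fg_commE !fhomM !fhomV !fhom_gen fe fo.
Qed.

End Surface.

Theorem theorem1p2 (m : nat) (hm : 1 <= m) (v : FG (2 * m)) :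
  Delta_primitive v ->
  exists phi : FG (2 * m) -> FG (2 * m), fg_aut phi /\ phi (u_surface m) = v.
Proof.
move=> /Delta_primitive_coboundary ontov.
have [w [vw cw ncw]] := no_cut_representative ontov.
have ontow := coboundary_onto_aut vw ontov.
have c1 l : count_mem l w <= 1 by apply: count_letter.
have n2 : 2 <= 2 * m by rewrite leq_pmulr.
have alw l : l \in w by apply: mem_no_cut => //; apply: c1.
have uw : uniq w.
  apply: count_mem_uniq => l; rewrite alw; apply/eqP.
  by rewrite eqn_leq c1 -has_count has_pred1 alw.
have [ps [wps ups alps]] := @commutator_normal_form _ [::] w uw alw ontow.
(* All 4m letters occur exactly once, four in each commutator. *)
have szps : size ps = m.
  have := card_uniqP ups; rewrite size_comm_word.
  rewrite (eq_card (B := predT)) ?cardT'; last by move=> l; rewrite alps.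
  by rewrite card_prod card_ord card_bool; lia.
have [phi phiA phiE] := aut_trans (u_surface_comm_word szps alps) (aut_sym (aut_trans vw wps)).
by exists phi.
Qed.
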